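(* Consider the following families of numerical semigroups, where $A$ denotes the minimal generating set of the semigroup: $\mathcal{F}_0$: Betti divisible numerical semigroups; $\mathcal{F}_1$: numerical semigroups with $\mathcal{M}_A=\operatorname{Gr}_A$; $\mathcal{F}_2$: numerical semigroups with $\mathcal{C}_A=\mathcal{U}_A$; $\mathcal{F}_3$: universally free numerical semigroups; $\mathcal{F}_4$: numerical semigroups with $\mathcal{C}_A\subseteq\mathcal{M}_A$; $\mathcal{F}_5$: circuit numerical semigroups. Then the following inclusions hold: (a) $\mathcal{F}_0\subsetneq\mathcal{F}_1\cap\mathcal{F}_2$; (b) $\mathcal{F}_1\cup\mathcal{F}_3\subseteq\mathcal{F}_4$; (c) $\mathcal{F}_2\subseteq\mathcal{F}_3\subsetneq\mathcal{F}_5$.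
   Context: $\mathbb{K}$ is an arbitrary field and $\mathbb{N}$ contains $0$. For positive integers $a_1,\ldots,a_n$, $\langle a_1,\ldots,a_n\rangle=\{u_1a_1+\cdots+u_na_n\mid u_i\in\mathbb{N}\}$. A numerical semigroup is a submonoid of $\mathbb{N}$ generated by a finite set of positive integers with greatest common divisor $1$; its minimal generating set is its unique generating set no proper subset of which generates it. For $A=\{a_1,\ldots,a_n\}$, the $A$-degree of $\mathbf{x}^{\mathbf{u}}=x_1^{u_1}\cdots x_n^{u_n}$ is $u_1a_1+\cdots+u_na_n$, and the toric ideal of $A$ is $I_A=\langle \mathbf{x}^{\mathbf{u}}-\mathbf{x}^{\mathbf{v}}\mid \deg_A(\mathbf{x}^{\mathbf{u}})=\deg_A(\mathbf{x}^{\mathbf{v}})\rangle\subseteq\mathbb{K}[x_1,\ldots,x_n]$. In all the sets below, a binomial is identified with its opposite. - Markov basis: a generating set of $I_A$ consisting of binomials $\mathbf{x}^{\mathbf{u}}-\mathbf{x}^{\mathbf{v}}\in I_A$ that is minimal with respect to inclusion. The universal Markov basis $\mathcal{M}_A$ is the union of all Markov bases. The $A$-degrees of the elements of a Markov basis do not depend on the Markov basis; they are called the Betti degrees of $I_A$. - Graver basis $\operatorname{Gr}_A$: the set of primitive binomials, where a nonzero binomial $\mathbf{x}^{\mathbf{u}}-\mathbf{x}^{\mathbf{v}}\in I_A$ is primitive if there is no other nonzero binomial $\mathbf{x}^{\mathbf{w}}-\mathbf{x}^{\mathbf{z}}\in I_A$ with $\mathbf{x}^{\mathbf{w}}\mid\mathbf{x}^{\mathbf{u}}$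 and $\mathbf{x}^{\mathbf{z}}\mid\mathbf{x}^{\mathbf{v}}$. - Universal Gröbner basis $\mathcal{U}_A$: the union of all reduced Gröbner bases of $I_A$ over all monomial orders. - Circuits $\mathcal{C}_A$: a binomial $\mathbf{x}^{\mathbf{u}}-\mathbf{x}^{\mathbf{v}}\in I_A$ is irreducible if $\operatorname{supp}(\mathbf{u})\cap\operatorname{supp}(\mathbf{v})=\emptyset$ (with $\operatorname{supp}(\mathbf{u})=\{i\mid u_i\neq0\}$) and the nonzero entries of $\mathbf{u}+\mathbf{v}$ are relatively prime; $\mathcal{C}_A$ is the set of irreducible binomials whose support $\operatorname{supp}(\mathbf{u})\cup\operatorname{supp}(\mathbf{v})$ is inclusion-minimal among nonzero binomials of $I_A$. Equivalently, $\mathcal{C}_A=\{x_i^{a_j/\gcd(a_i,a_j)}-x_j^{a_i/\gcd(a_i,a_j)}\mid i\neq j\}$. A numerical semigroup with minimal generating set $A=\{a_1,\ldots,a_n\}$ is: free for the arrangement $(a_1,\ldots,a_n)$ if $\operatorname{lcm}\big(a_i,\gcd(a_{i+1},\ldots,a_n)\big)\in\langle a_{i+1},\ldots,a_n\rangle$ for all $i\in\{1,\ldots,n-1\}$; universally free if it is free for every arrangement (ordering) of its minimal generating set; Betti divisible if the Betti degrees of $I_A$ are (totally) ordered by divisibility; a circuit numerical semigroup if $I_A=\langle\mathcal{C}_A\rangle$. *)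

(* Defs.v *)
From HB Require Import structures.
From mathcomp Require Import all_boot all_order all_algebra.
From mathcomp Require Import mpoly.
Set Implicit Arguments.
Unset Strict Implicit.
Unset Printing Implicit Defensive.
Import GRing.Theory.
Local Open Scope ring_scope.

Definition gcd_seq (s : seq nat) : nat := \big[gcdn/0%N]_(x <- s) x.

Definition semigroup_span (s : seq nat) (m : nat) : Prop :=
  exists u : nat -> nat, m = (\sum_(i < size s) u i * nth 0 s i)%N.

Definition generates (s : seq nat) (S : nat -> Prop) : Prop :=
  forall m, S m <-> semigroup_span s m.

Definition numerical_semigroup (S : nat -> Prop) : Prop :=
  exists s : seq nat, [/\ all (leq 1) s, gcd_seq s = 1%N & generates s S].

(* A finite set of naturals is encoded by its increasing enumeration, so that
   the tuple [a] is uniquely determined by [S]. *)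
Definition minimal_generating_set (S : nat -> Prop) n (a : n.-tuple nat) : Prop :=
  [/\ sorted ltn a, generates a S &
      forall s : seq nat, {subset s <= a} -> generates s S -> {subset a <= s}].

(* [s] is the list (a_1, ..., a_n); the index [i] is shifted by one. *)
Definition free_for (s : seq nat) : Prop :=
  forall i, (i.+1 < size s)%N ->
    semigroup_span (drop i.+1 s) (lcmn (nth 0%N s i) (gcd_seq (drop i.+1 s))).

Definition universally_free n (a : n.-tuple nat) : Prop :=
  forall s : seq nat, perm_eq s a -> free_for s.

Section ToricIdeal.
Variables (K : fieldType) (n : nat).
Implicit Types (f g : {mpoly K[n]}) (u v w z m : 'X_{1..n}).
Implicit Types (B I : {mpoly K[n]} -> Prop) (G : seq {mpoly K[n]}).

Definition ideal_gen B f : Prop :=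
  exists2 s : seq ({mpoly K[n]} * {mpoly K[n]}),
    (forall p, p \in s -> B p.2) & f = \sum_(p <- s) p.1 * p.2.

(* Inclusion and equality of sets of polynomials when f and -f are
   identified. *)
Definition sub_pm B B' : Prop := forall f, B f -> B' f \/ B' (- f).
Definition eq_pm B B' : Prop := sub_pm B B' /\ sub_pm B' B.

Definition diff_binomial u v : {mpoly K[n]} := 'X_[u] - 'X_[v].

Definition monomial_order (le : rel 'X_{1..n}) : Prop :=
  [/\ total le, antisymmetric le, transitive le, forall m, le 0%MM m &
      forall m u v, le u v -> le (u + m)%MM (v + m)%MM].

Definition is_lead_monomial (le : rel 'X_{1..n}) f m : Prop :=
  m \in msupp f /\ forall m', m' \in msupp f -> le m' m.

(* Over a field, leading terms and leading monomials generate the same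
   ideal. *)
Definition initial_ideal (le : rel 'X_{1..n}) B : {mpoly K[n]} -> Prop :=
  ideal_gen (fun p => exists f m, [/\ B f, is_lead_monomial le f m & p = 'X_[m]]).

Definition groebner_basis (le : rel 'X_{1..n}) I G : Prop :=
  (forall g, g \in G -> I g) /\
  (forall f, initial_ideal le (fun g => g \in G) f <-> initial_ideal le I f).

Definition reduced_groebner_basis (le : rel 'X_{1..n}) I G : Prop :=
  [/\ groebner_basis le I G,
      forall g, g \in G -> exists2 m, is_lead_monomial le g m & g@_m = 1 &
      forall g g' m m', g \in G -> g' \in G -> g' != g ->
        m \in msupp g -> is_lead_monomial le g' m' -> ~~ (m' <= m)%MM].

Variable a : n.-tuple nat.

Definition Adeg u : nat := (\sum_(i < n) u i * tnth a i)%N.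

Definition toric_ideal : {mpoly K[n]} -> Prop :=
  ideal_gen (fun f => exists u v, Adeg u = Adeg v /\ f = diff_binomial u v).

Definition binomial_generating_set B : Prop :=
  (forall f, B f -> toric_ideal f /\ exists u v, f = diff_binomial u v) /\
  (forall f, ideal_gen B f <-> toric_ideal f).

Definition markov_basis B : Prop :=
  binomial_generating_set B /\
  forall B', (forall f, B' f -> B f) -> binomial_generating_set B' ->
    forall f, B f -> B' f.

Definition universal_markov_basis f : Prop := exists2 B, markov_basis B & B f.

(* The two monomials of a binomial of the toric ideal have the same
   A-degree. *)
Definition betti_degree (b : nat) : Prop :=
  exists B u v, [/\ markov_basis B, B (diff_binomial u v) & b = Adeg u].

Definition betti_divisible : Prop :=
  forall b b', betti_degree b -> betti_degree b' -> (b %| b')%N \/ (b' %| b)%N.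

Definition primitive u v : Prop :=
  [/\ toric_ideal (diff_binomial u v), diff_binomial u v <> 0 &
      forall w z, toric_ideal (diff_binomial w z) -> diff_binomial w z <> 0 ->
        (w <= u)%MM -> (z <= v)%MM -> w = u /\ z = v].

Definition graver_basis f : Prop :=
  exists u v, primitive u v /\ f = diff_binomial u v.

Definition universal_groebner_basis f : Prop :=
  exists (le : rel 'X_{1..n}) (G : seq {mpoly K[n]}),
    [/\ monomial_order le, reduced_groebner_basis le toric_ideal G & f \in G].

Definition supp u : {set 'I_n} := [set i | u i != 0%N].

Definition irreducible_binomial u v : Prop :=
  [/\ toric_ideal (diff_binomial u v), supp u :&: supp v = set0 &
      \big[gcdn/0%N]_(i < n) (u i + v i)%N = 1%N].

Definition circuit u v : Prop :=
  [/\ irreducible_binomial u v, diff_binomial u v <> 0 &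
      forall w z, toric_ideal (diff_binomial w z) -> diff_binomial w z <> 0 ->
        supp w :|: supp z \subset supp u :|: supp v ->
        supp w :|: supp z = supp u :|: supp v].

Definition circuits f : Prop := exists u v, circuit u v /\ f = diff_binomial u v.

End ToricIdeal.

Definition family := (nat -> Prop) -> Prop.

Definition semigroups_with (P : forall n, n.-tuple nat -> Prop) : family :=
  fun S => numerical_semigroup S /\
    exists n (a : n.-tuple nat), minimal_generating_set S a /\ P n a.

Definition family_sub (F G : family) : Prop := forall S, F S -> G S.
Definition family_proper (F G : family) : Prop :=
  family_sub F G /\ exists S, G S /\ ~ F S.
Definition family_cap (F G : family) : family := fun S => F S /\ G S.
Definition family_cup (F G : family) : family := fun S => F S \/ G S.

Section Families.
Variable K : fieldType.

Definition F0 : family := semigroups_with (fun n a => @betti_divisible K n a).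

Definition F1 : family := semigroups_with (fun n a =>
  eq_pm (@universal_markov_basis K n a) (@graver_basis K n a)).

Definition F2 : family := semigroups_with (fun n a =>
  eq_pm (@circuits K n a) (@universal_groebner_basis K n a)).

Definition F3 : family := semigroups_with universally_free.

Definition F4 : family := semigroups_with (fun n a =>
  sub_pm (@circuits K n a) (@universal_markov_basis K n a)).

Definition F5 : family := semigroups_with (fun n a =>
  forall f, toric_ideal a f <-> ideal_gen (@circuits K n a) f).

End Families.

(* Main.v *)
Require Import Defs.
From mathcomp Require Import all_boot all_order all_algebra.
From mathcomp Require Import perm ssrcomplements mpoly zify.
From Stdlib Require Import Classical ClassicalDescription.
Set Implicit Arguments.
Unset Strict Implicit.
Unset Printing Implicit Defensive.
Import GRing.Theory.

(** Every polynomial question is first turned into a question on exponent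
    vectors.  A binomial X^u - X^v lies in the ideal generated by a set of
    binomials exactly when u and v are congruent for the least congruence of
    monomials that contains the generating pairs ([cong_ideal_gen],
    [ideal_gen_cong]).  For the toric ideal this says that X^u - X^v is a
    member when u and v have the same degree, and it gives the criteria on
    which the proof rests:
    - X^u - X^v belongs to some Markov basis iff u and v have the same degree
      d and are not congruent modulo the toric pairs of degree below d
      ([markov_not_lower], [not_lower_markov]);
    - a primitive pair has bounded degree, and every other pair of equal
      degree is congruent modulo pairs of lower degree
      ([primitive_pair_bound], [primitive_or_lower]); hence Markov bases are
      made of primitive binomials;
    - call a monomial standard for a monomial order if it is the least one of
      its degree; the elements of the reduced Groebner basis are the X^m - X^s
      with m minimal among the nonstandard monomials and s standard
      ([universal_groebner_form], [min_nonstandard_groebner]).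

    Circuits are the binomials x_i^p - x_j^q with p a_i = q a_j = lcm(a_i, a_j)
    ([circuitP]).  They are always primitive, and always belong to the
    universal Groebner basis: take a lexicographic order with x_i and x_j last
    ([circuits_sub_groebner]).

    F2 in F3.  Suppose that all reduced Groebner bases consist of circuits, so
    that every initial ideal is generated by pure powers.  Freeness for an
    arrangement only concerns an index i and the set B of the later indices;
    put r a_i = lcm(a_i, gcd B).  Some relation x_i^r x^p ~ x^q has p and q
    supported in B and p standard; for the lexicographic order of the
    arrangement its left-hand side is nonstandard, which is only possible if
    it is divisible by a generator x_i^c with c <= r.  The binomial of the
    basis with this leading term shows that c a_i is in the semigroup of B,
    whence c = r ([circuit_groebner_free]).

    F3 in F4 and F5.  Universal freeness is hereditary, and for a set A of
    generators a comparison of the numbers lcm(a_p, gcd(A - p)) shows that two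
    of them, the least ones, are equal ([free_least_lcm]).  Removing one of
    these two indices, an induction gives that lcm(a_i, gcd B) is, for all i
    and B, the lcm of a_i with one a_j, j in B ([free_circuit]).  Thus the
    generators x_i^r - x^w given by freeness can be chosen to be circuits, with
    any prescribed circuit being one of them; it is irredundant, because
    a weight function kills all the others ([free_generation]).

    F0 in F1 and F2.  Let c_i be the least exponent such that c_i a_i is in the
    semigroup of the other generators, and L_i = c_i a_i.  The L_i are Betti
    degrees, so they form a chain for divisibility.  Then lcm(a_i, a_j) is the
    larger of L_i and L_j, which forces all exponents of a pair with disjoint
    supports to be multiples of the c_i ([chain_blocks]).  A chain of divisors
    allows one to pay an amount exactly ([knapsack]); therefore one side of
    a primitive pair is a pure power x_j^{c_j} with L_j maximal
    ([chain_primitive_pair]).  Such a power is alone in its class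
    ([least_power_isolated]), which gives the equality of the Markov and Graver
    bases, and the other side is a pure power or contains the product of two
    distinct factors of the same degree, which does not occur in a reduced
    Groebner basis
    ([groebner_sub_circuits]).

    Strictness.  For 60, 84, 350, 525 the Betti degrees 420 and 1050 are not
    comparable for divisibility, while the primitive pairs can be listed
    ([primitive_special]).  For 4, 6, 9 the circuits x^3 - y^2 and y^3 - z^2
    generate the ideal, but lcm(6, gcd(4, 9)) = 6 is not in the semigroup of
    4 and 9. *)

(** * Congruences of monomials and binomial ideals *)

(** Classical truth value, so that classes of congruences can be used as
    boolean predicates. *)
Definition asbool (P : Prop) : bool :=
  if excluded_middle_informative P then true else false.

Lemma asboolP P : reflect P (asbool P).
Proof. by rewrite /asbool; case: excluded_middle_informative => h; constructor. Qed.

Section Congruence.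
Variable n : nat.
Implicit Types (u v w z m : 'X_{1..n}) (R : 'X_{1..n} -> 'X_{1..n} -> Prop).

Inductive cong R : 'X_{1..n} -> 'X_{1..n} -> Prop :=
| cong_step m u v of R u v : cong R (m + u)%MM (m + v)%MM
| cong_refl u : cong R u u
| cong_sym u v of cong R u v : cong R v u
| cong_trans u v w of cong R u v & cong R v w : cong R u w.

Lemma cong_base R u v : R u v -> cong R u v.
Proof. by move=> Ruv; rewrite -[u]add0m -[v]add0m; apply: cong_step. Qed.

Lemma cong_addl R m u v : cong R u v -> cong R (m + u)%MM (m + v)%MM.
Proof.
elim=> {u v} [k u v Ruv|u|u v _ IH|u v w _ IHu _ IHv].
- by rewrite !addmA; apply: cong_step.
- exact: cong_refl.
- exact: cong_sym.
- exact: cong_trans IHu IHv.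
Qed.

Lemma cong_add R u v w z :
  cong R u v -> cong R w z -> cong R (u + w)%MM (v + z)%MM.
Proof.
move=> Cuv Cwz; apply: (cong_trans (cong_addl _ Cwz)).
by rewrite ![(_ + z)%MM]addmC; apply: cong_addl.
Qed.

Lemma cong_muln R k u v : cong R u v -> cong R (u *+ k)%MM (v *+ k)%MM.
Proof.
move=> Cuv; elim: k => [|k IH]; first exact: cong_refl.
by rewrite !mulmS; apply: cong_add.
Qed.

Lemma cong_generated R R' u v :
  (forall u v, R u v -> cong R' u v) -> cong R u v -> cong R' u v.
Proof.
move=> sRR'; elim=> {u v} [k u v Ruv|u|u v _ IH|u v w _ IHu _ IHv].
- exact/cong_addl/sRR'.
- exact: cong_refl.
- exact: cong_sym.
- exact: cong_trans IHu IHv.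
Qed.

Lemma cong_invariant R (P : 'X_{1..n} -> Prop) u v :
    (forall m u v, R u v -> (P (m + u)%MM <-> P (m + v)%MM)) ->
  cong R u v -> (P u <-> P v).
Proof.
move=> invP; elim=> {u v} [k u v Ruv|u|u v _ IH|u v w _ IHu _ IHv].
- exact: invP.
- by [].
- by rewrite IH.
- by rewrite IHu.
Qed.

(** Additive invariants are how two monomials are shown not to be congruent. *)
Lemma cong_weight (V : nmodType) R (wt : 'X_{1..n} -> V) u v :
    {morph wt : u v / (u + v)%MM >-> (u + v)%R} ->
    (forall u v, R u v -> wt u = wt v) ->
  cong R u v -> wt u = wt v.
Proof.
move=> wtD Rwt Cuv.
have: wt u = wt u <-> wt v = wt u.
  apply: (cong_invariant (P := fun x => wt x = wt u)) Cuv => m w z /Rwt wz.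
  by rewrite !wtD wz.
by case=> /(_ erefl).
Qed.

End Congruence.

Section IdealGen.
Variables (K : fieldType) (n : nat).
Implicit Types (u v w z m : 'X_{1..n}) (f g : {mpoly K[n]}).
Implicit Types (B : {mpoly K[n]} -> Prop) (R : 'X_{1..n} -> 'X_{1..n} -> Prop).
Local Open Scope ring_scope.

Lemma ideal_gen_mem B f : B f -> ideal_gen B f.
Proof.
move=> Bf; exists [:: (1, f)]; first by move=> p; rewrite inE => /eqP->.
by rewrite big_seq1 mul1r.
Qed.

Lemma ideal_gen0 B : ideal_gen B 0.
Proof. by exists [::]; rewrite ?big_nil. Qed.

Lemma ideal_genD B f g : ideal_gen B f -> ideal_gen B g -> ideal_gen B (f + g).
Proof.
case=> s Bs -> [t Bt ->]; exists (s ++ t); last by rewrite big_cat.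
by move=> p; rewrite mem_cat => /orP[/Bs|/Bt].
Qed.

Lemma ideal_genM B f g : ideal_gen B g -> ideal_gen B (f * g).
Proof.
case=> s Bs ->; exists [seq (f * p.1, p.2) | p <- s].
  by move=> p /mapP[q /Bs Bq ->].
by rewrite big_map mulr_sumr; apply: eq_bigr => p _; rewrite mulrA.
Qed.

Lemma ideal_genN B f : ideal_gen B f -> ideal_gen B (- f).
Proof. by rewrite -mulN1r; apply: ideal_genM. Qed.

Lemma ideal_gen_trans B B' f :
  (forall g, B g -> ideal_gen B' g) -> ideal_gen B f -> ideal_gen B' f.
Proof.
move=> sBB' [s Bs ->]; rewrite big_seq.
apply: (big_ind (ideal_gen B')); first exact: ideal_gen0.
  by move=> g h; apply: ideal_genD.
by move=> p ps; apply/ideal_genM/sBB'/Bs.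
Qed.

Lemma diff_binomialN u v : - diff_binomial K u v = diff_binomial K v u.
Proof. by rewrite /diff_binomial opprB. Qed.

Lemma cong_ideal_gen B R u v :
    (forall u v, R u v -> ideal_gen B (diff_binomial K u v)) ->
  cong R u v -> ideal_gen B (diff_binomial K u v).
Proof.
move=> RB; elim=> {u v} [k u v Ruv|u|u v _ IH|u v w _ IHu _ IHv].
- by rewrite /diff_binomial !mpolyXD -mulrBr; apply/ideal_genM/RB.
- by rewrite /diff_binomial subrr; apply: ideal_gen0.
- by rewrite -diff_binomialN; apply: ideal_genN.
- suff <- : diff_binomial K u v + diff_binomial K v w = diff_binomial K u w.
    exact: ideal_genD.
  by rewrite /diff_binomial addrA subrK.
Qed.

(** The linear functional that separates binomial ideals: it vanishes on an
    ideal generated by binomials whose two monomials stay on the same side of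
    P after any translation. *)
Definition class_sum (P : pred 'X_{1..n}) f : K := \sum_(m <- msupp f | P m) f@_m.

Lemma class_sumE P f k : (msize f <= k)%N ->
  class_sum P f = \sum_(m : 'X_{1..n < k} | P m) f@_m.
Proof.
move=> le_fk; rewrite /class_sum big_mkcond [RHS]big_mkcond /=.
rewrite (big_mksub 'X_{1..n < k}) ?msupp_uniq //=; last first.
  by move=> x /msize_mdeg_lt /leq_trans; apply.
rewrite big_rmcond //= => j /memN_msupp_eq0 ->.
by rewrite if_same.
Qed.

Lemma class_sumB P f g : class_sum P (f - g) = class_sum P f - class_sum P g.
Proof.
set k := maxn (msize (f - g)) (maxn (msize f) (msize g)).
rewrite !(@class_sumE _ _ k) ?leq_max ?leqnn ?orbT //.
by rewrite -sumrB; apply: eq_bigr => m _; rewrite mcoeffB.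
Qed.

Lemma class_sum0 P : class_sum P 0 = 0.
Proof. by rewrite -(subrr 0) class_sumB subrr. Qed.

Lemma class_sumD P f g : class_sum P (f + g) = class_sum P f + class_sum P g.
Proof.
rewrite -[g in LHS]opprK class_sumB -[- g]add0r class_sumB class_sum0.
by rewrite sub0r opprK.
Qed.

Lemma class_sumZX P c m : class_sum P (c *: 'X_[m]) = c * (P m)%:R.
Proof.
rewrite (@class_sumE _ _ (maxn (msize (c *: 'X_[m])) (mdeg m).+1)) ?leq_maxl //.
have lt_m : (mdeg m < maxn (msize (c *: 'X_[m])) (mdeg m).+1)%N.
  by rewrite leq_max leqnn orbT.
rewrite big_mkcond (bigD1 (BMultinom lt_m)) //= mcoeffZ mcoeffX eqxx mulr1.
rewrite big1 ?addr0 => [|j].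
  by case: (P m); rewrite ?mulr1 ?mulr0.
rewrite -val_eqE /= => nj; rewrite mcoeffZ mcoeffX eq_sym (negPf nj) mulr0.
by rewrite if_same.
Qed.

Lemma class_sumX P m : class_sum P 'X_[m] = (P m)%:R.
Proof. by rewrite -[X in class_sum _ X]scale1r class_sumZX mul1r. Qed.

Lemma class_sum_ideal_gen B (P : pred 'X_{1..n}) f :
    (forall g, B g -> exists u v, g = diff_binomial K u v /\
       forall m, P (m + u)%MM = P (m + v)%MM) ->
  ideal_gen B f -> class_sum P f = 0.
Proof.
move=> invP [s Bs ->]; rewrite big_seq.
apply: (big_ind (fun g => class_sum P g = 0)); first exact: class_sum0.
  by move=> g h; rewrite class_sumD => -> ->; rewrite addr0.
move=> [p g] /Bs /invP[u [v [/= -> Puv]]] {s Bs}.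
elim/mpolyind: p => [|c m p _ _ IH]; first by rewrite mul0r class_sum0.
rewrite mulrDl class_sumD {}IH addr0 /diff_binomial mulrBr class_sumB.
by rewrite -!scalerAl -!mpolyXD !class_sumZX Puv subrr.
Qed.

(** Sum the coefficients over the class of u: the functional vanishes on the
    generators, hence on X^u - X^v, whose sum would be 1 if v were outside the
    class. *)
Lemma ideal_gen_cong B R u v :
    (forall g, B g -> exists u v, g = diff_binomial K u v /\ cong R u v) ->
  ideal_gen B (diff_binomial K u v) -> cong R u v.
Proof.
move=> BR Iuv.
pose P w := asbool (cong R u w); have PE w : reflect (cong R u w) (P w) := asboolP _.
have := @class_sum_ideal_gen B P _ _ Iuv.
rewrite /diff_binomial class_sumB !class_sumX.
have -> : P u by apply/PE/cong_refl.
case: (PE v) => [//|nC] h; exfalso.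
have /eqP: (1 - 0 : K) = 0; last by rewrite subr0 oner_eq0.
apply: h => g /BR[w [z [gE Cwz]]]; exists w, z; split=> // m.
apply/PE/PE => h; apply: (cong_trans h); first exact: cong_addl.
exact/cong_sym/cong_addl.
Qed.

Lemma diff_binomial_eq0 u v : diff_binomial K u v = 0 <-> u = v.
Proof.
split=> [/eqP|->]; last by rewrite /diff_binomial subrr.
rewrite subr_eq0 => /eqP/(congr1 (mcoeff u)); rewrite !mcoeffX eqxx.
by case: eqP => // _ /eqP; rewrite oner_eq0.
Qed.

Lemma diff_binomial_inj u v w z : u != v ->
  diff_binomial K u v = diff_binomial K w z -> (u = w /\ v = z) \/ (u = z /\ v = w).
Proof.
move=> neq_uv eq_d.
have co m : (u == m)%:R - (v == m)%:R = (w == m)%:R - (z == m)%:R :> K.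
  by have := congr1 (mcoeff m) eq_d; rewrite !mcoeffB !mcoeffX.
have [eq_wz|neq_wz] := eqVneq w z.
  have/diff_binomial_eq0 eq_uv: diff_binomial K u v = 0.
    by rewrite eq_d eq_wz; apply/diff_binomial_eq0.
  by rewrite eq_uv eqxx in neq_uv.
have := co u; have := co v; rewrite !eqxx (negPf neq_uv) [v == u]eq_sym (negPf neq_uv).
have one0 : (1 : K) <> 0 by apply/eqP/oner_neq0.
move: neq_wz; have [->|_] := eqVneq w u; have [->|_] := eqVneq z u => //=.
- have [->|_] := eqVneq z v; first by left.
  by rewrite (negPf neq_uv) subr0 sub0r => _ /eqP; rewrite oppr_eq0 oner_eq0.
- have [->|nwv] := eqVneq w v; first by right.
  by rewrite (negPf neq_uv) subr0 sub0r => _ /eqP; rewrite oppr_eq0 oner_eq0.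
- by rewrite subrr subr0 => _ _ /one0.
Qed.

End IdealGen.

(** * Degrees, primitive pairs and Markov bases *)

Lemma mulmDn n (u : 'X_{1..n}) k l : (u *+ (k + l) = u *+ k + u *+ l)%MM.
Proof. by apply/mnmP => i; rewrite mnmDE !mulmnE mulnDr. Qed.

Lemma mulmMn n (u : 'X_{1..n}) k l : (u *+ (k * l) = u *+ k *+ l)%MM.
Proof. by apply/mnmP => i; rewrite !mulmnE mulnA. Qed.

Lemma mnm_le_subK n (u w : 'X_{1..n}) : (w <= u)%MM -> exists t, u = (t + w)%MM.
Proof. by move=> /submK <-; exists (u - w)%MM. Qed.

Section Degree.
Variables (n : nat) (a : n.-tuple nat).
Implicit Types (u v w z m : 'X_{1..n}).

Lemma AdegD u v : Adeg a (u + v)%MM = Adeg a u + Adeg a v.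
Proof.
by rewrite /Adeg -big_split; apply: eq_bigr => i _; rewrite mnmDE mulnDl.
Qed.

Lemma Adeg0 : Adeg a 0%MM = 0.
Proof. by rewrite /Adeg big1 // => i _; rewrite mnm0E. Qed.

Lemma AdegMn u k : Adeg a (u *+ k)%MM = k * Adeg a u.
Proof. by elim: k => [|k IH]; rewrite ?Adeg0 // mulmS AdegD IH. Qed.

Lemma Adeg1 i : Adeg a U_(i)%MM = tnth a i.
Proof.
rewrite /Adeg (bigD1 i) //= mnm1E eqxx mul1n big1 ?addn0 // => j nj.
by rewrite mnm1E eq_sym (negPf nj).
Qed.

Lemma Adeg_pow i k : Adeg a (U_(i) *+ k)%MM = k * tnth a i.
Proof. by rewrite AdegMn Adeg1. Qed.

Lemma powE (i : 'I_n) k j : (U_(i) *+ k)%MM j = if i == j then k else 0 :> nat.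
Proof. by rewrite mulmnE mnm1E; case: eqP; rewrite ?mul1n. Qed.

Lemma pow_le (i : 'I_n) k u : (U_(i) *+ k <= u)%MM = (k <= u i).
Proof.
apply/mnm_lepP/idP => [/(_ i)|le_k j]; rewrite powE ?eqxx //.
by case: eqP => // <-.
Qed.

Lemma leq_term_Adeg u i : u i * tnth a i <= Adeg a u.
Proof. by rewrite /Adeg (bigD1 i) //= leq_addr. Qed.

Lemma leq_Adeg u v : (u <= v)%MM -> Adeg a u <= Adeg a v.
Proof.
by move/mnm_lepP=> le_uv; apply: leq_sum => i _; rewrite leq_mul2r le_uv orbT.
Qed.

(** The toric relations of degree below d; for a pair of degree d, they are
    the relations that cannot be avoided in a Markov basis. *)
Definition lower d u v := Adeg a u = Adeg a v /\ Adeg a u < d.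

(** Every step of a chain m + w ~ m + z from u to v stays in the fibre of u,
    so it uses a pair (w, z) of degree at most that of u. *)
Lemma cong_homogeneous R u v :
    (forall w z, R w z -> Adeg a w = Adeg a z) -> cong R u v ->
  cong (fun w z => R w z /\ Adeg a w <= Adeg a u) u v.
Proof.
move=> homR; suff H: cong R u v ->
    Adeg a u = Adeg a v /\ cong (fun w z => R w z /\ Adeg a w <= Adeg a u) u v.
  by move=> /H[].
elim=> {u v} [k u v Ruv|u|u v _ [uv IH]|u v w _ [uv IHu] _ [vw IHv]].
- rewrite !AdegD (homR _ _ Ruv); split=> //; apply: cong_step.
  by rewrite (homR _ _ Ruv) leq_addl.
- by split=> //; apply: cong_refl.
- by rewrite -uv; split=> //; apply: cong_sym.
- by rewrite -uv in vw IHv; split=> //; apply: cong_trans IHu IHv.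
Qed.

Lemma Adeg_neq0_coord u : Adeg a u <> 0 -> exists i, u i != 0.
Proof.
move=> u0; apply: NNPP => nex; apply: u0; rewrite /Adeg big1 // => i _.
by case: (u i =P 0) => [->//|/eqP ui]; case: nex; exists i.
Qed.

Hypothesis apos : forall i, 0 < tnth a i.

Lemma Adeg_eq0 u : Adeg a u = 0 -> u = 0%MM.
Proof.
move=> u0; apply/mnmP => i; rewrite mnm0E; apply/eqP.
have := leq_term_Adeg u i; rewrite u0 leqn0 muln_eq0.
by rewrite (gtn_eqF (apos i)) orbF.
Qed.

Lemma neq_pair_coord u v : Adeg a u = Adeg a v -> u <> v -> exists i, u i != 0.
Proof.
move=> eq_uv ne_uv; apply: Adeg_neq0_coord => u0; apply: ne_uv.
by rewrite (Adeg_eq0 u0) (Adeg_eq0 (etrans (esym eq_uv) u0)).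
Qed.

Lemma leq_mdeg_Adeg u : mdeg u <= Adeg a u.
Proof. by rewrite mdegE; apply: leq_sum => i _; apply: leq_pmulr. Qed.

Lemma leq_Adeg_eq u v : (u <= v)%MM -> Adeg a u = Adeg a v -> u = v.
Proof.
move=> /mnm_le_subK[t ->]; rewrite AdegD => /esym/eqP.
by rewrite -{2}[Adeg a u]add0n eqn_add2r => /eqP/Adeg_eq0->; rewrite add0m.
Qed.

Definition monomials_upto d : seq 'X_{1..n} := [seq val m | m : 'X_{1..n < d.+1}].

Lemma mem_monomials_upto d u : Adeg a u <= d -> u \in monomials_upto d.
Proof.
move=> le_u; have lt_u : mdeg u < d.+1 by rewrite ltnS (leq_trans (leq_mdeg_Adeg u)).
by apply/mapP; exists (BMultinom lt_u); rewrite ?mem_enum.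
Qed.

(** Primitivity of X^u - X^v in terms of exponents only; see [primitiveP]. *)
Definition primitive_pair u v :=
  [/\ Adeg a u = Adeg a v, u <> v &
      forall w z, Adeg a w = Adeg a z -> w <> z -> (w <= u)%MM -> (z <= v)%MM ->
        w = u /\ z = v].

Lemma primitive_pair_sym u v : primitive_pair u v -> primitive_pair v u.
Proof.
case=> eq_uv ne_uv minuv; split=> //; first by move=> eq_vu; apply: ne_uv.
move=> w z eq_wz ne_wz lew lez.
by case: (minuv z w) => // eq_zw; apply: ne_wz.
Qed.

Lemma primitive_pair_disjoint u v i : primitive_pair u v -> u i = 0 \/ v i = 0.
Proof.
case=> eq_uv ne_uv minuv.
have [->|ui0] := eqVneq (u i) 0; first by left.
have [->|vi0] := eqVneq (v i) 0; first by right.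
have [t tE] := mnm_le_subK (etrans (lep1mP i u) ui0).
have [s sE] := mnm_le_subK (etrans (lep1mP i v) vi0).
case: (minuv t s).
- by apply/eqP; move/eqP: eq_uv; rewrite tE sE !AdegD eqn_add2r.
- by move=> ts; apply: ne_uv; rewrite tE sE ts.
- by rewrite tE lem_addr.
- by rewrite sE lem_addr.
rewrite tE => /(congr1 (Adeg a)); rewrite AdegD Adeg1 => /eqP.
by rewrite -{1}[Adeg a t]addn0 eqn_add2l eq_sym (gtn_eqF (apos i)).
Qed.

(** If w <= u and z <= v is a smaller pair, then u = t + w ~ t + z ~ s + z =
    v, where s = v - z: the first step has the degree of w and the second one
    that of t, both less than that of u. *)
Lemma primitive_or_lower u v : Adeg a u = Adeg a v ->
  primitive_pair u v \/ cong (lower (Adeg a u)) u v.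
Proof.
move=> eq_uv; have [->|/eqP ne_uv] := eqVneq u v; first by right; apply: cong_refl.
case: (classic (primitive_pair u v)) => [|nprim]; [by left|right].
have: ~ forall w z, Adeg a w = Adeg a z -> w <> z -> (w <= u)%MM -> (z <= v)%MM ->
        w = u /\ z = v by move=> h; apply: nprim.
move=> /not_all_ex_not[w] /not_all_ex_not[z] h.
have {h} [eq_wz ne_wz lew lez ne] :
    [/\ Adeg a w = Adeg a z, w <> z, (w <= u)%MM, (z <= v)%MM & ~ (w = u /\ z = v)].
  by split; apply: NNPP => h'; tauto.
have ltw : Adeg a w < Adeg a u.
  rewrite ltn_neqAle leq_Adeg // andbT; apply/eqP => eq_wu; apply: ne.
  by split; apply: leq_Adeg_eq; rewrite // -eq_wz eq_wu.
have w_gt0 : 0 < Adeg a w.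
  by have [i wi] := neq_pair_coord eq_wz ne_wz;
     apply: leq_trans (leq_term_Adeg w i); rewrite muln_gt0 lt0n wi apos.
have [t tE] := mnm_le_subK lew; have [s sE] := mnm_le_subK lez.
have eq_ts : Adeg a t = Adeg a s.
  by apply/eqP; move/eqP: eq_uv; rewrite tE sE !AdegD eq_wz eqn_add2r.
apply: (@cong_trans _ _ _ (t + z)%MM).
  by rewrite {2}tE; apply: cong_step.
rewrite sE ![(_ + z)%MM]addmC; apply: cong_step; split=> //.
by rewrite tE AdegD -{1}[Adeg a t]addn0 ltn_add2l.
Qed.

(** In the second case u is neither standard nor a minimal nonstandard
    monomial, whatever the order: one of the proper factors y, w is
    nonstandard. *)
Definition pure_or_split u := (exists i, u = (U_(i) *+ u i)%MM) \/
  exists y w, [/\ y <> w, Adeg a y = Adeg a w & (y + w <= u)%MM].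

Definition amax := \max_(i < n) tnth a i.

Lemma leq_amax i : tnth a i <= amax. Proof. exact: leq_bigmax. Qed.

Lemma large_coord u : n * (amax * amax) < Adeg a u -> exists i, amax <= u i.
Proof.
move=> lt_u; apply: NNPP => nex; move: lt_u; apply/negP; rewrite -leqNgt.
have -> : n * (amax * amax) = \sum_(i < n) amax * amax.
  by rewrite sum_nat_const card_ord.
apply: leq_sum => i _; apply: leq_mul (leq_amax i).
by rewrite leqNgt; apply/negP => lt_a; apply: nex; exists i; apply: ltnW.
Qed.

(** In large degree some u_i and some v_j are at least max a, and the pair
    (a_j e_i, a_i e_j) lies below (u, v). *)
Lemma primitive_pair_bound u v : primitive_pair u v -> Adeg a u <= n * (amax * amax).
Proof.
move=> prim; have [eq_uv ne_uv minuv] := prim.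
rewrite leqNgt; apply/negP => lt_u.
have [i lei] := large_coord lt_u.
have [j lej] : exists j, amax <= v j by apply: large_coord; rewrite -eq_uv.
have ne_ij : i != j.
  apply/eqP => ij; move: lej lei; rewrite ij.
  have amax0 := leq_trans (apos j) (leq_amax j).
  by case: (primitive_pair_disjoint j prim) => -> *; lia.
have [] := minuv (U_(i) *+ tnth a j)%MM (U_(j) *+ tnth a i)%MM.
- by rewrite !Adeg_pow mulnC.
- move=> /mnmP/(_ i); rewrite !powE eqxx eq_sym (negPf ne_ij) => a0.
  by have := apos j; rewrite a0.
- by rewrite pow_le (leq_trans (leq_amax j)).
- by rewrite pow_le (leq_trans (leq_amax i)).
move=> /(congr1 (Adeg a)); rewrite Adeg_pow => eq_u _; move: lt_u.
rewrite -eq_u ltnNge => /negP; apply.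
apply: leq_trans (leq_mul (leq_amax j) (leq_amax i)) _.
by apply/leq_pmull/(leq_ltn_trans (leq0n i)).
Qed.

(** The toric ideal is generated by its binomials of bounded degree; hence it
    has finite generating sets of binomials. *)
Lemma cong_bounded_degree u v : Adeg a u = Adeg a v ->
  cong (fun w z => Adeg a w = Adeg a z /\ Adeg a w <= n * (amax * amax)) u v.
Proof.
elim: {u}(Adeg a u).+1 {-2}u (ltnSn (Adeg a u)) v => // d IH u ltd v eq_uv.
case: (primitive_or_lower eq_uv) => [prim|].
  by apply: cong_base; split=> //; apply: primitive_pair_bound prim.
elim=> {v eq_uv} [m w z [eq_wz lt_w]|w|w z _|w z t _ C1 _ C2].
- by apply/cong_addl/IH => //; apply: leq_trans lt_w _.
- exact: cong_refl.
- exact: cong_sym.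
- exact: cong_trans C1 C2.
Qed.

End Degree.

Section Toric.
Variables (K : fieldType) (n : nat) (a : n.-tuple nat).
Implicit Types (u v w z m : 'X_{1..n}) (f g : {mpoly K[n]}).
Implicit Types (B : {mpoly K[n]} -> Prop).

Lemma toric_diff u v :
  toric_ideal a (diff_binomial K u v) <-> Adeg a u = Adeg a v.
Proof.
split=> [h|eq_uv]; last by apply: ideal_gen_mem; exists u, v.
have: cong (fun w z => Adeg a w = Adeg a z) u v.
  apply: ideal_gen_cong h => g [w [z [eq_wz ->]]].
  by exists w, z; split=> //; apply: cong_base.
by apply: (cong_weight (V := nat)) => // w z; rewrite AdegD.
Qed.

(** The coefficients of f at the monomials of a given degree sum to 0, so a
    degree cannot occur only once. *)
Lemma toric_other_term f m : toric_ideal a f -> m \in msupp f ->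
  exists m', [/\ m' \in msupp f, m' <> m & Adeg a m' = Adeg a m].
Proof.
move=> tf mf; apply: NNPP => nex.
have := @class_sum_ideal_gen _ _ _ (fun m' => Adeg a m' == Adeg a m) _ _ tf.
have -> : class_sum (fun m' => Adeg a m' == Adeg a m) f = (f@_m)%R.
  rewrite /class_sum big_mkcond (bigD1_seq m) ?msupp_uniq //= eqxx.
  rewrite big1_seq ?addr0 // => m' /andP[/eqP ne_m m'f].
  by case: eqP => // eq_m; case: nex; exists m'.
move=> h; move: mf; rewrite mcoeff_msupp h ?eqxx // => g [u [v [eq_uv ->]]].
by exists u, v; split=> // t; rewrite !AdegD eq_uv.
Qed.

Lemma toric_ideal_gen B :
    (forall u v, Adeg a u = Adeg a v -> ideal_gen B (diff_binomial K u v)) ->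
  forall f, toric_ideal a f -> ideal_gen B f.
Proof. by move=> h f; apply: ideal_gen_trans => g [u [v [/h ? ->]]]. Qed.

Lemma primitiveP u v : primitive K a u v <-> primitive_pair a u v.
Proof.
split=> [[/toric_diff eq_uv ne_uv minuv]|[/toric_diff eq_uv ne_uv minuv]].
  split=> // [/(diff_binomial_eq0 K)//|w z /toric_diff wz ne_wz].
  by apply: minuv; [exact: wz|move=> /diff_binomial_eq0].
split=> // [/diff_binomial_eq0//|w z /toric_diff wz ne_wz].
by apply: minuv => // /(diff_binomial_eq0 K).
Qed.

Lemma subset_generating_set B B' :
    binomial_generating_set a B -> (forall f, B' f -> B f) ->
    (forall f, B f -> ideal_gen B' f) -> binomial_generating_set a B'.
Proof.
move=> [binB genB] sBB' genB'; split=> [f /sBB'/binB//|f].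
split=> [h|/genB]; last exact: ideal_gen_trans.
by apply/genB; apply: ideal_gen_trans h => g /sBB'; apply: ideal_gen_mem.
Qed.

(** If u and v were congruent modulo lower degrees, then X^u - X^v would be in
    the ideal of the elements of lower degree of the Markov basis, and could
    be removed from it. *)
Lemma markov_not_lower u v :
    universal_markov_basis a (diff_binomial K u v) ->
  Adeg a u = Adeg a v /\ ~ cong (lower a (Adeg a u)) u v.
Proof.
set f := diff_binomial K u v => -[B [genB minB] Bf].
have [/toric_diff eq_uv _] := proj1 genB f Bf.
split=> // Cuv; pose B' g := B g /\ g <> f.
suff fB' : ideal_gen B' f.
  have [] // : B' f.
  apply: minB Bf => [g []//|]; apply: (subset_generating_set genB) => [g []//|g Bg].
  have [->//|/eqP ne_gf] := eqVneq g f.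
  by apply: ideal_gen_mem.
have [eq|ne_uv] := eqVneq u v.
  by rewrite /f /diff_binomial eq subrr; apply: ideal_gen0.
apply: cong_ideal_gen Cuv => w z [eq_wz lt_w].
have Bwz : ideal_gen B (diff_binomial K w z) by apply/(proj2 genB)/toric_diff.
have {Bwz} : cong (fun x y => B (diff_binomial K x y)) w z.
  apply: ideal_gen_cong Bwz => g Bg; have [_ [x [y gE]]] := proj1 genB g Bg.
  by exists x, y; split=> //; apply: cong_base; rewrite -gE.
move/(cong_homogeneous (a := a)) => h; apply: cong_ideal_gen (h _) => [x y [Bxy le_xw]|x y Bxy].
  apply: ideal_gen_mem; split=> // /esym/(diff_binomial_inj ne_uv).
  by case=> -[eqx eqy]; move: le_xw lt_w; rewrite -?eqx -?eqy -?eq_uv; lia.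
by have [/toric_diff] := proj1 genB _ Bxy.
Qed.

(** Remove superfluous elements one after the other. *)
Lemma prune_generating_set (s : seq {mpoly K[n]}) :
    binomial_generating_set a (fun g => g \in s) ->
  exists2 t : seq {mpoly K[n]}, {subset t <= s} & markov_basis a (fun g => g \in t).
Proof.
elim: {s}(size s).+1 {-2}s (ltnSn (size s)) => // k IH s lt_s gens.
case: (classic (markov_basis a (fun g => g \in s))) => [mb|nmb]; first by exists s.
have : ~ forall B', (forall f, B' f -> f \in s) -> binomial_generating_set a B' ->
    forall f, f \in s -> B' f by move=> h; apply: nmb.
move=> /not_all_ex_not[B' h].
have sB's f : B' f -> f \in s by apply: NNPP => h'; apply: h => h''; case: h' => /h''.
have genB' : binomial_generating_set a B' by apply: NNPP => h'; apply: h.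
have [f [fs nf]] : exists f, f \in s /\ ~ B' f.
  apply: NNPP => h'; apply: h => _ _ f fs; apply: NNPP => nf.
  by apply: h'; exists f.
pose t := [seq g <- s | asbool (B' g)].
have tE g : g \in t <-> B' g.
  rewrite mem_filter; split=> [/andP[/asboolP//]|Bg].
  by rewrite sB's // andbT; apply/asboolP.
have [||t' st't mt'] := IH t.
- rewrite -ltnS (leq_trans _ lt_s) // ltnS size_filter ltnNge; apply/negP => le_c.
  have : all (fun g => asbool (B' g)) s by rewrite all_count eqn_leq count_size.
  by move=> /allP/(_ f fs)/asboolP.
- split=> [g /tE/(proj1 genB')//|g]; rewrite -(proj2 genB').
  by split; apply: ideal_gen_trans => h' /tE; apply: ideal_gen_mem.
by exists t' => // g /st't; rewrite mem_filter => /andP[].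
Qed.

Hypothesis apos : forall i, 0 < tnth a i.

(** Let P be the class of u modulo the lower pairs. All toric pairs of bounded
    degree, except those of degree d that cross the border of P, generate the
    toric ideal together with X^u - X^v. Without X^u - X^v nothing connects u
    to v, so that this element survives when the set is pruned. *)
Lemma not_lower_markov u v :
    Adeg a u = Adeg a v -> ~ cong (lower a (Adeg a u)) u v ->
  universal_markov_basis a (diff_binomial K u v).
Proof.
move=> eq_uv nC; set f := diff_binomial K u v; set d := Adeg a u in nC.
pose P w := asbool (cong (lower a d) u w).
have PE w : reflect (cong (lower a d) u w) (P w) := asboolP _.
have Pu : P u by apply/PE/cong_refl.
have nPv : P v = false by apply/PE.
pose D := maxn (n * (amax a * amax a)) d.
pose E w z := [&& Adeg a w == Adeg a z, Adeg a w <= D & (Adeg a w == d) ==> (P w == P z)].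
pose mons := monomials_upto n D; have monsP := mem_monomials_upto apos (d := D).
pose G := f :: [seq diff_binomial K p.1 p.2 |
   p <- [seq (w, z) | w <- mons, z <- mons] & E p.1 p.2].
have GE w z : E w z -> diff_binomial K w z \in G.
  move=> Ewz; rewrite inE; apply/orP; right; apply/mapP; exists (w, z) => //.
  rewrite mem_filter Ewz; case/and3P: Ewz => /eqP eq_wz le_w _.
  by apply/allpairsP; exists (w, z); rewrite !monsP // -eq_wz.
have GP g : g \in G -> g = f \/ exists w z, g = diff_binomial K w z /\ E w z.
  rewrite inE => /orP[/eqP->|/mapP[[w z]]]; first by left.
  by rewrite mem_filter => /andP[Ewz _] ->; right; exists w, z.
have genG : binomial_generating_set a (fun g => g \in G).
  have GT g : g \in G -> toric_ideal a g /\ exists w z, g = diff_binomial K w z.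
    case/GP=> [->|[w [z [-> /and3P[/eqP eq_wz _ _]]]]].
      by split; [apply/toric_diff|exists u, v].
    by split; [apply/toric_diff|exists w, z].
  split=> // g; split=> [|tg].
    case=> s sG ->; rewrite big_seq.
    apply: (big_ind (toric_ideal a)); [exact: ideal_gen0|exact: ideal_genD|].
    by move=> p /sG/GT[? _]; apply: ideal_genM.
  apply: toric_ideal_gen tg => w z /(cong_bounded_degree apos) Cwz.
  have {Cwz} : cong (fun x y => diff_binomial K x y \in G) w z.
    elim: Cwz => {w z} [m w z [eq_wz le_w]|w|w z _|w z x _ C1 _]; first last.
    - exact: cong_trans C1.
    - exact: cong_sym.
    - exact: cong_refl.
    apply: cong_addl; have le_wD : Adeg a w <= D by rewrite leq_max le_w.
    have [Ewz|] := boolP (E w z); first by apply/cong_base/GE.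
    rewrite /E eq_wz eqxx -eq_wz le_wD /= negb_imply => /andP[/eqP wd].
    have fG : diff_binomial K u v \in G by rewrite inE eqxx.
    have dD : d <= D by rewrite leq_maxr.
    have EP x y : Adeg a x = d -> Adeg a y = d -> P x = P y ->
        cong (fun x y => diff_binomial K x y \in G) x y.
      by move=> xd yd Pxy; apply/cong_base/GE; rewrite /E xd yd Pxy !eqxx dD.
    (* A pair that crosses the border of P makes a detour through (u, v). *)
    have [Pw|nPw] := boolP (P w); have [Pz|nPz] := boolP (P z) => // _.
      apply: (@cong_trans _ _ _ u); first by apply: EP; rewrite ?Pw.
      apply: (@cong_trans _ _ _ v); first exact: cong_base.
      by apply: EP; rewrite -?eq_wz // nPv (negPf nPz).
    apply: (@cong_trans _ _ _ v); first by apply: EP; rewrite ?nPv ?(negPf nPw).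
    apply: (@cong_trans _ _ _ u); first exact/cong_sym/cong_base.
    by apply: EP; rewrite -?eq_wz // Pu Pz.
  by apply: cong_ideal_gen => x y; apply: ideal_gen_mem.
have [t stG mt] := prune_generating_set genG.
exists (fun g => g \in t) => //; apply/negPn/negP => nft.
have ft : ideal_gen (fun g => g \in t) f by apply/(proj2 (proj1 mt))/toric_diff.
pose R w z := Adeg a w = Adeg a z /\ (Adeg a w = d -> P w = P z).
have {ft} Cuv : cong R u v.
  apply: ideal_gen_cong ft => g gt.
  have [eq_gf|[w [z [-> /and3P[/eqP eq_wz _ /implyP Pwz]]]]] := GP g (stG g gt).
    by rewrite -eq_gf gt in nft.
  by exists w, z; split=> //; apply: cong_base; split=> // /eqP/Pwz/eqP.
(* Only the fibre of degree d matters, hence the guard on the degree. *)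
have := cong_invariant (P := fun w => Adeg a w = d -> P w) _ Cuv.
case=> [m w z [eq_wz Pwz]|h _]; last first.
  by have := h (fun _ => Pu) (esym eq_uv); rewrite nPv.
rewrite !AdegD -eq_wz; suff Pm : Adeg a m + Adeg a w = d -> P (m + w)%MM = P (m + z)%MM.
  by split=> h e; [rewrite -Pm // h|rewrite Pm // h].
have [->|m0] := eqVneq m 0%MM; first by rewrite !add0m Adeg0.
move=> md; have Cm : cong (lower a d) (m + w)%MM (m + z)%MM.
  apply: cong_step; split=> //; rewrite -md -{1}[Adeg a w]add0n ltn_add2r lt0n.
  by apply: contraNneq m0 => /(Adeg_eq0 apos)->.
apply/PE/PE => h; apply: cong_trans h _ => //; exact: cong_sym.
Qed.

Lemma lower_pair_betti u v :
    Adeg a u = Adeg a v -> ~ cong (lower a (Adeg a u)) u v ->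
  betti_degree K a (Adeg a u).
Proof.
move=> eq_uv nC; have [B mB Bf] := not_lower_markov eq_uv nC.
by exists B, u, v.
Qed.

Lemma markov_primitive u v :
  universal_markov_basis a (diff_binomial K u v) -> primitive_pair a u v.
Proof.
move=> /markov_not_lower[eq_uv nC].
by case: (primitive_or_lower apos eq_uv).
Qed.

End Toric.

(** * Circuits *)

Section Circuits.
Variables (K : fieldType) (n : nat) (a : n.-tuple nat).
Implicit Types (u v w z m : 'X_{1..n}) (i j : 'I_n).

(** The exponent of x_i in the circuit supported by i and j. *)
Definition cexp i j := lcmn (tnth a i) (tnth a j) %/ tnth a i.

Lemma cexpE i j : cexp i j * tnth a i = lcmn (tnth a i) (tnth a j).
Proof. by rewrite divnK ?dvdn_lcml. Qed.

Lemma cexp_swap i j : cexp i j * tnth a i = cexp j i * tnth a j.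
Proof. by rewrite !cexpE lcmnC. Qed.

Lemma Adeg_cexp i j :
  Adeg a (U_(i) *+ cexp i j)%MM = Adeg a (U_(j) *+ cexp j i)%MM.
Proof. by rewrite !Adeg_pow cexp_swap. Qed.

Hypothesis apos : forall i, 0 < tnth a i.

Lemma cexp_gt0 i j : 0 < cexp i j.
Proof. by rewrite -(ltn_pmul2r (apos i)) mul0n cexpE lcmn_gt0 !apos. Qed.

Lemma cexp_dvd i j p q : p * tnth a i = q * tnth a j ->
  exists k, p = k * cexp i j /\ q = k * cexp j i.
Proof.
move=> eq_pq; have /dvdnP[k kE]: lcmn (tnth a i) (tnth a j) %| p * tnth a i.
  by rewrite dvdn_lcm dvdn_mull // eq_pq dvdn_mull.
exists k; split; apply/eqP.
  by rewrite -(eqn_pmul2r (apos i)) -mulnA cexpE kE.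
by rewrite -(eqn_pmul2r (apos j)) -mulnA cexpE -eq_pq kE lcmnC.
Qed.

Lemma coprime_cexp i j : coprime (cexp i j) (cexp j i).
Proof.
rewrite /coprime; set g := gcdn _ _.
have g0 : 0 < g by rewrite gcdn_gt0 cexp_gt0.
have /dvdnP[p pE] : g %| cexp i j by apply: dvdn_gcdl.
have /dvdnP[q qE] : g %| cexp j i by apply: dvdn_gcdr.
have eq_pq : p * tnth a i = q * tnth a j.
  by apply/eqP; rewrite -(eqn_pmul2l g0) !mulnA ![g * _]mulnC -pE -qE cexp_swap.
have [k [kE _]] := cexp_dvd eq_pq.
have /eqP : k * g = 1.
  by apply/eqP; rewrite -(eqn_pmul2r (cexp_gt0 i j)) mul1n {2}pE kE mulnAC.
by rewrite muln_eq1 => /andP[].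
Qed.

(** If i and j are in the supports of the two monomials of a circuit, then
    x_i^{a_j} - x_j^{a_i} has smaller support, so the supports are {i} and
    {j}. *)
Lemma circuitP u v : circuit K a u v <->
  exists i j, [/\ i != j, u = (U_(i) *+ cexp i j)%MM & v = (U_(j) *+ cexp j i)%MM].
Proof.
split=> [[[/toric_diff eq_uv dis gcd1] /diff_binomial_eq0 ne_uv minuv]|].
  have dis' k : u k = 0 \/ v k = 0.
    have : k \notin supp u :&: supp v by rewrite dis inE.
    by rewrite !inE negb_and !negbK => /orP[/eqP|/eqP]; [left|right].
  have [i ui] := neq_pair_coord apos eq_uv ne_uv.
  have [j vj] := neq_pair_coord apos (esym eq_uv) (nesym ne_uv).
  have ne_ij : i != j by apply/eqP => ij; subst j; case: (dis' i) => h; rewrite h in ui vj.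
  have suppE : supp (U_(i) *+ tnth a j)%MM :|: supp (U_(j) *+ tnth a i)%MM = supp u :|: supp v.
    apply: minuv.
    - by apply/toric_diff; rewrite !Adeg_pow mulnC.
    - move=> /diff_binomial_eq0/mnmP/(_ i); rewrite !powE eqxx eq_sym (negPf ne_ij) => a0.
      by have := apos j; rewrite a0.
    apply/subsetP => k; rewrite !inE !powE.
    have [<-|_] := eqVneq i k; first by rewrite ui.
    by have [<-|//] := eqVneq j k; rewrite vj !orbT.
  have out k : k != i -> k != j -> u k = 0 /\ v k = 0.
    move=> ki kj; have := in_setU k (supp u) (supp v); rewrite -suppE !inE !powE.
    rewrite ![_ == k]eq_sym (negPf ki) (negPf kj) /= => /esym/negbT.
    by rewrite negb_or !negbK => /andP[/eqP-> /eqP->].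
  have uE : u = (U_(i) *+ u i)%MM.
    apply/mnmP => k; rewrite powE; case: eqP => [->//|/nesym/eqP ki].
    have [->|kj] := eqVneq k j; last by case: (out k ki kj).
    by case: (dis' j) => // h; rewrite h in vj.
  have vE : v = (U_(j) *+ v j)%MM.
    apply/mnmP => k; rewrite powE; case: eqP => [->//|/nesym/eqP kj].
    have [->|ki] := eqVneq k i; last by case: (out k ki kj).
    by case: (dis' i) => // h; rewrite h in ui.
  have : u i * tnth a i = v j * tnth a j by rewrite -!Adeg_pow -uE -vE.
  case/cexp_dvd => k [ukE vkE]; exists i, j.
  suff k1 : k = 1 by rewrite uE vE ukE vkE k1 !mul1n.
  apply/eqP; rewrite -dvdn1 -gcd1; apply/dvdn_biggcdP => l _.
  by rewrite uE vE !powE ukE vkE; apply: dvdn_add; case: eqP; rewrite ?dvdn0 ?dvdn_mulr.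
move=> [i [j [ne_ij -> ->]]].
have suppp k p : 0 < p -> supp (U_(k) *+ p)%MM = [set k].
  move=> p0; apply/setP => l; rewrite !inE powE [l == k]eq_sym.
  by case: (k =P l) => // _; rewrite -lt0n p0.
split.
- split; first by apply/toric_diff/Adeg_cexp.
    rewrite !suppp ?cexp_gt0 //; apply/setP => k; rewrite !inE.
    by have [->|//] := eqVneq k i; rewrite (negPf ne_ij).
  apply/eqP; rewrite -dvdn1; have := coprime_cexp i j; rewrite /coprime => /eqP g1.
  rewrite -[X in _ %| X]g1 dvdn_gcd; apply/andP.
  split; [apply: (biggcdn_inf i)|apply: (biggcdn_inf j)] => //.
    by rewrite !powE eqxx eq_sym (negPf ne_ij) addn0.
  by rewrite !powE eqxx (negPf ne_ij).
- move=> /diff_binomial_eq0/mnmP/(_ i); rewrite !powE eqxx eq_sym (negPf ne_ij) => c0.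
  by have := cexp_gt0 i j; rewrite c0.
move=> w z /toric_diff eq_wz ne_wz; rewrite !suppp ?cexp_gt0 // => sub.
apply/eqP; rewrite eqEsubset sub /=; apply/subsetP => k; rewrite !inE.
have key l l' : (forall x, x != l -> x != l' -> w x = 0 /\ z x = 0) ->
    (w l != 0) || (z l != 0).
  move=> out; apply/negPn/negP; rewrite negb_or !negbK => /andP[/eqP wl /eqP zl].
  apply: ne_wz; apply/diff_binomial_eq0.
  have E (x : 'X_{1..n}) : (forall y, y != l -> y != l' -> x y = 0) ->
      x l = 0 -> x = (U_(l') *+ x l')%MM.
    move=> ox xl; apply/mnmP => y; rewrite powE; case: eqP => [->//|/nesym/eqP yl'].
    by have [->//|yl] := eqVneq y l; apply: ox.
  have wE := E w (fun y h1 h2 => proj1 (out y h1 h2)) wl.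
  have zE := E z (fun y h1 h2 => proj2 (out y h1 h2)) zl.
  have := eq_wz; rewrite wE zE !Adeg_pow => /eqP.
  by rewrite eqn_pmul2r // => /eqP->.
have out x : x != i -> x != j -> w x = 0 /\ z x = 0.
  move=> xi xj; have /implyP := subsetP sub x.
  rewrite !inE (negPf xi) (negPf xj) implybF negb_or !negbK.
  by case/andP => /eqP-> /eqP->.
by case/orP => /eqP->; [apply: (key i j)|apply: (key j i)] => // x xj xi; apply: out.
Qed.

(** By [cexp_dvd], the exponents in a relation between powers of x_i and x_j
    are a common multiple of those of the circuit. *)
Lemma circuit_primitive_pair u v : circuit K a u v -> primitive_pair a u v.
Proof.
move=> /circuitP[i [j [ne_ij uE vE]]]; subst u v; split; first exact: Adeg_cexp.
  move=> /mnmP/(_ i); rewrite !powE eqxx eq_sym (negPf ne_ij) => c0.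
  by have := cexp_gt0 i j; rewrite c0.
move=> w z eq_wz ne_wz le_w le_z.
have E (x : 'X_{1..n}) l p : (x <= U_(l) *+ p)%MM -> x = (U_(l) *+ x l)%MM.
  move=> /mnm_lepP h; apply/mnmP => y; have := h y; rewrite !powE.
  by case: eqP => [->//|_]; rewrite leqn0 => /eqP.
have wE := E _ _ _ le_w; have zE := E _ _ _ le_z.
have [k [kw kz]] : exists k, w i = k * cexp i j /\ z j = k * cexp j i.
  by apply: cexp_dvd; rewrite -!Adeg_pow -wE -zE.
have k0 : 0 < k.
  rewrite lt0n; apply/eqP => k0; apply: ne_wz; rewrite wE zE kw kz k0 !mul0n.
  by rewrite !mulm0n.
move: le_w le_z; rewrite wE zE !pow_le !powE !eqxx kw kz => le1 _.
have k1 : k = 1 by have := cexp_gt0 i j; move: le1; nia.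
by rewrite k1 !mul1n.
Qed.

Lemma circuits_sub_graver (f : {mpoly K[n]}) : circuits a f -> graver_basis a f.
Proof.
case=> u [v [cuv ->]]; exists u, v; split=> //.
exact/primitiveP/circuit_primitive_pair.
Qed.

End Circuits.

(** * Monomial orders and reduced Groebner bases *)

Lemma seq_least (T : eqType) (le : rel T) (x0 : T) (s : seq T) :
    total le -> transitive le -> x0 \in s ->
  exists2 x, x \in s & forall y, y \in s -> le x y.
Proof.
move=> tot tr; elim: s x0 => // x s IH x0 _.
have xx : le x x by have /orP[] := tot x x.
case: s IH => [_|y s /(_ y (mem_head _ _))[z zs zmin]].
  by exists x; rewrite ?mem_head // => y; rewrite inE => /eqP->.
have /orP[xz|zx] := tot x z.
  exists x; rewrite ?mem_head // => t; rewrite inE => /orP[/eqP->//|/zmin].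
  exact: tr.
exists z; first by rewrite inE zs orbT.
by move=> t; rewrite inE => /orP[/eqP->//|/zmin].
Qed.

Section MonomialOrder.
Variables (n : nat) (a : n.-tuple nat) (le : rel 'X_{1..n}).
Implicit Types (u v w z m : 'X_{1..n}).
Hypothesis le_mo : monomial_order le.

Lemma mo_refl : reflexive le.
Proof. by case: le_mo => tot _ _ _ _ m; have /orP[] := tot m m. Qed.

Lemma mo_anti u v : le u v -> le v u -> u = v.
Proof. by case: le_mo => _ anti _ _ _ uv vu; apply: anti; rewrite uv vu. Qed.

Lemma mo_total u v : le u v \/ le v u.
Proof. by case: le_mo => tot _ _ _ _; have /orP[] := tot u v; [left|right]. Qed.

Lemma mo_add m u v : le u v -> le (m + u)%MM (m + v)%MM.
Proof. by case: le_mo => _ _ _ _ ad /(ad m); rewrite ![(_ + m)%MM]addmC. Qed.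

Lemma mo_dvd u v : (u <= v)%MM -> le u v.
Proof.
case: le_mo => _ _ _ le0 ad /mnm_le_subK[t ->].
by have := ad u _ _ (le0 t); rewrite add0m.
Qed.

(** The standard monomials of the order le, that is the monomials outside the
    initial ideal of the toric ideal: see [lead_toric_nonstandard]. *)
Definition standard m := forall m', Adeg a m' = Adeg a m -> le m m'.

Lemma standard_dvd m m' : standard m -> (m' <= m)%MM -> standard m'.
Proof.
move=> stm /mnm_le_subK[t tE] x eqx.
have [//|lex] := mo_total m' x.
have := stm (t + x)%MM; rewrite tE !AdegD eqx => /(_ erefl) /mo_anti.
by move=> /(_ (mo_add t lex)) /addmI->; apply: mo_refl.
Qed.

Lemma standard_unique m m' :
  standard m -> standard m' -> Adeg a m = Adeg a m' -> m = m'.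
Proof. by move=> sm sm' eq_m; apply: mo_anti; [apply: sm|apply: sm']. Qed.

(** The minimal monomial generators of the initial ideal. *)
Definition min_nonstandard m :=
  ~ standard m /\ forall m', (m' <= m)%MM -> m' <> m -> standard m'.

Lemma nonstandard_dvd m : ~ standard m ->
  exists2 m', (m' <= m)%MM & min_nonstandard m'.
Proof.
elim: {m}(mdeg m).+1 {-2}m (ltnSn (mdeg m)) => // k IH m ltm nsm.
case: (classic (min_nonstandard m)) => [|nmin].
  by exists m => //; apply: lepm_refl.
have: ~ forall m', (m' <= m)%MM -> m' <> m -> standard m' by move=> h; apply: nmin.
move=> /not_all_ex_not[m' h].
have [le_m' ne_m' ns_m'] : [/\ (m' <= m)%MM, m' <> m & ~ standard m'].
  by split; apply: NNPP => h'; tauto.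
have [|m'' le_m'' min_m''] := IH m' _ ns_m'.
  apply: leq_trans (_ : mdeg m' < mdeg m) _ => //.
  have [t tE] := mnm_le_subK le_m'; rewrite tE mdegD -{1}[mdeg m']add0n ltn_add2r.
  by rewrite lt0n mdeg_eq0; apply/eqP => t0; apply: ne_m'; rewrite tE t0 add0m.
by exists m'' => //; apply: lepm_trans le_m'.
Qed.

Hypothesis apos : forall i, 0 < tnth a i.

Lemma standard_exists m : exists2 s, standard s & Adeg a s = Adeg a m.
Proof.
pose fib := [seq m' <- monomials_upto n (Adeg a m) | Adeg a m' == Adeg a m].
have fibP x : x \in fib <-> Adeg a x = Adeg a m.
  rewrite mem_filter; split=> [/andP[/eqP]//|eqx].
  by rewrite eqx eqxx (mem_monomials_upto apos) ?eqx.
case: le_mo => tot _ tr _ _.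
have [s /fibP sm smin] := seq_least tot tr ((fibP m).2 erefl).
by exists s => // x xs; apply/smin/fibP; rewrite xs.
Qed.

(** Below (m, s), the second component is standard, and so is the first one
    unless it is m; two standard monomials of the same degree are equal. *)
Lemma min_nonstandard_pair m s :
  min_nonstandard m -> standard s -> Adeg a m = Adeg a s -> primitive_pair a m s.
Proof.
move=> [nsm minm] ss eq_ms; split=> // [ms|w z eq_wz ne_wz le_w le_z].
  by apply: nsm; rewrite ms.
have sz := standard_dvd ss le_z.
have wm : w = m.
  apply: NNPP => ne_wm; apply: ne_wz.
  exact: standard_unique (minm _ le_w ne_wm) sz eq_wz.
by split=> //; apply: (leq_Adeg_eq apos le_z); rewrite -eq_wz wm.
Qed.

Variable K : fieldType.
Implicit Types (f g : {mpoly K[n]}) (B : {mpoly K[n]} -> Prop).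

Lemma lead_unique f m m' :
  is_lead_monomial le f m -> is_lead_monomial le f m' -> m = m'.
Proof. by case=> mf maxm [m'f maxm']; apply: mo_anti; [apply: maxm'|apply: maxm]. Qed.

Lemma lead_exists f : f <> 0%R -> exists m, is_lead_monomial le f m.
Proof.
move=> f0; case: le_mo => tot _ tr _ _.
have [m mf] : exists m, m \in msupp f.
  case E: (msupp f) => [|m s]; last by exists m; rewrite mem_head.
  by case: f0; apply/eqP; rewrite -msupp_eq0 E.
have [|y x z|m' m'f max] := @seq_least _ (fun x y => le y x) m (msupp f) _ _ mf.
- by move=> x y /=; rewrite orbC; apply: tot.
- by move=> h1 h2; apply: tr h2 h1.
by exists m'.
Qed.

Lemma initial_idealP B m : initial_ideal le B 'X_[m] <->
  exists f m', [/\ B f, is_lead_monomial le f m' & (m' <= m)%MM].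
Proof.
split=> [[s sP eq_m]|[f [m' [Bf lf /mnm_le_subK[t ->]]]]].
  have : m \in msupp ('X_[m] : {mpoly K[n]}) by rewrite msuppX mem_head.
  rewrite eq_m => /msupp_sum_le/flattenP[_ /mapP[p ps ->]].
  have [f [m' [Bf lf ->]]] := sP p (mem_subseq (filter_subseq _ _) ps).
  rewrite (perm_mem (msuppMX _ _)) => /mapP[t _ mE].
  by exists f, m'; split=> //; rewrite mE lem_addr.
by rewrite mpolyXD; apply/ideal_genM/ideal_gen_mem; exists f, m'.
Qed.

Lemma msupp_diff u v m : u <> v ->
  m \in msupp (diff_binomial K u v) <-> m = u \/ m = v.
Proof.
move=> /eqP ne_uv; rewrite mcoeff_msupp mcoeffB !mcoeffX.
have [nu|nu] := eqVneq u m.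
  by rewrite -nu [v == u]eq_sym (negPf ne_uv) subr0 oner_neq0; split=> //; left.
have [->|nv] := eqVneq v m; rewrite ?subrr ?sub0r ?oppr_eq0 ?oner_neq0 ?eqxx.
  by split=> //; right.
by split=> // -[] e; move: nu nv; rewrite e eqxx.
Qed.

Lemma lead_toric_nonstandard f m :
  toric_ideal a f -> is_lead_monomial le f m -> ~ standard m.
Proof.
move=> tf [mf maxm] sm; have [m' [m'f ne_m' eq_m']] := toric_other_term tf mf.
by apply: ne_m'; apply: mo_anti; [apply: maxm|apply: sm].
Qed.

Lemma lead_diff m s : m <> s -> standard s -> Adeg a m = Adeg a s ->
  is_lead_monomial le (diff_binomial K m s) m /\ ((diff_binomial K m s)@_m = 1)%R.
Proof.
move=> ne_ms ss eq_ms; split; last first.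
  rewrite mcoeffB !mcoeffX eqxx; case: eqP => [sm|]; last by rewrite subr0.
  by case: ne_ms.
split=> [|m']; first by apply/msupp_diff => //; left.
by move=> /msupp_diff; case=> // ->; [apply: mo_refl|apply: ss].
Qed.

End MonomialOrder.

Section Groebner.
Variables (K : fieldType) (n : nat) (a : n.-tuple nat).
Hypothesis apos : forall i, 0 < tnth a i.
Implicit Types (u v w z m : 'X_{1..n}) (f g : {mpoly K[n]}).

(** The leading monomial m of f is a minimal generator of the initial ideal
    and the other terms of f are standard, since the basis is reduced. If s is
    the standard monomial of the degree of m, then all the terms of f - (X^m -
    X^s) are standard, so that it is zero. *)
Lemma universal_groebner_form f : universal_groebner_basis a f ->
  exists (le : rel 'X_{1..n}) m s, [/\ monomial_order le, min_nonstandard a le m,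
    standard a le s, Adeg a m = Adeg a s & f = diff_binomial K m s].
Proof.
case=> le [G [mo [[GI GE] monic red] fG]].
have [m lm fm1] := monic f fG.
have nsm := lead_toric_nonstandard mo (GI _ fG) lm.
have leadG m' : ~ standard a le m' ->
    exists g m0, [/\ g \in G, is_lead_monomial le g m0 & (m0 <= m')%MM].
  move=> nsm'; apply/initial_idealP/GE/initial_idealP.
  have [s ss sm'] := standard_exists mo apos m'.
  have ne : m' <> s by move=> e; apply: nsm'; rewrite e.
  exists (diff_binomial K m' s), m'; split; last exact: lepm_refl.
    by apply/toric_diff; rewrite sm'.
  by case: (lead_diff mo K ne ss (esym sm')).
have tailf m' : m' \in msupp f -> m' <> m -> standard a le m'.
  move=> m'f ne_m'; apply: NNPP => /leadG[g [m0 [gG lg le_m0]]].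
  have [eq_gf|ne_gf] := eqVneq g f; last first.
    by move: (red f g m' m0 fG gG ne_gf m'f lg); rewrite le_m0.
  rewrite eq_gf in lg; rewrite (lead_unique mo lg lm) in le_m0.
  apply: ne_m'; apply: (mo_anti mo); last exact: mo_dvd le_m0.
  by case: lm => _; apply.
have [s ss sm] := standard_exists mo apos m.
have ne_ms : m <> s by move=> e; apply: nsm; rewrite e.
exists le, m, s; split=> //.
  split=> // m' le_m' ne_m'; apply: NNPP => /leadG[g [m0 [gG lg le_m0]]].
  have [eq_gf|ne_gf] := eqVneq g f.
    rewrite eq_gf in lg; rewrite (lead_unique mo lg lm) in le_m0.
    by apply: ne_m'; apply: (mo_anti mo); apply: (mo_dvd mo).
  have := red f g m m0 fG gG ne_gf (proj1 lm) lg.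
  by rewrite (lepm_trans le_m0 le_m').
apply/eqP; rewrite -subr_eq0; apply/negPn/negP => /eqP nz.
have [m' lm'] := lead_exists mo nz.
have th : toric_ideal a (f - diff_binomial K m s)%R.
  by apply: ideal_genD; [apply: GI|apply/ideal_genN/toric_diff].
apply: (lead_toric_nonstandard mo th lm').
have [->//|/eqP ne_s] := eqVneq m' s.
case: lm' => m'h _; have ne_m : m' <> m.
  move=> e; move: m'h; rewrite e mcoeff_msupp mcoeffB fm1.
  by rewrite (proj2 (lead_diff mo K ne_ms ss (esym sm))) subrr eqxx.
apply: tailf => //; move: m'h; rewrite !mcoeff_msupp mcoeffB.
apply: contraNneq => ->; rewrite sub0r oppr_eq0 mcoeff_eq0.
by apply/negP => /(msupp_diff K m' ne_ms) [].
Qed.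

(** The binomials X^m - X^s of this form are the reduced Groebner basis; they
    are finitely many because they are primitive. *)
Lemma min_nonstandard_groebner (le : rel 'X_{1..n}) m s :
    monomial_order le -> min_nonstandard a le m -> standard a le s ->
    Adeg a m = Adeg a s ->
  universal_groebner_basis a (diff_binomial K m s).
Proof.
move=> mo minm ss eq_ms; pose D := n * (amax a * amax a).
pose good (p : 'X_{1..n} * 'X_{1..n}) :=
  [/\ min_nonstandard a le p.1, standard a le p.2 & Adeg a p.1 = Adeg a p.2].
pose mons := monomials_upto n D; have monsP := mem_monomials_upto apos (d := D).
pose G := [seq diff_binomial K p.1 p.2 |
   p <- [seq (w, z) | w <- mons, z <- mons] & asbool (good p)].
have GP f : f \in G <-> exists w z, good (w, z) /\ f = diff_binomial K w z.
  split=> [/mapP[[w z]]|[w [z [gwz ->]]]].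
    by rewrite mem_filter => /andP[/asboolP gwz _] ->; exists w, z.
  apply/mapP; exists (w, z) => //; rewrite mem_filter; apply/andP; split.
    exact/asboolP.
  have [gw gz eq_wz] := gwz.
  have bw := primitive_pair_bound apos (min_nonstandard_pair mo apos gw gz eq_wz).
  by apply/allpairsP; exists (w, z); rewrite !monsP // -eq_wz.
have neq w z : good (w, z) -> w <> z.
  by case=> [[nsw _] sz _] e; apply: nsw; rewrite e.
have leadG w z : good (w, z) -> is_lead_monomial le (diff_binomial K w z) w /\
    ((diff_binomial K w z)@_w = 1)%R.
  by move=> gwz; have [_ sz eq_wz] := gwz; apply: lead_diff sz eq_wz => //; apply: neq.
exists le, G; split=> //; last by apply/GP; exists m, s.
split.
- have GI g : g \in G -> toric_ideal a g.
    by move=> /GP[w [z [[_ _ eq_wz] ->]]]; apply/toric_diff.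
  split=> // f; split; apply: ideal_gen_trans => p [g [m' [gG lg ->]]].
    by apply: ideal_gen_mem; exists g, m'; split=> //; apply: GI.
  have [w le_w minw] := nonstandard_dvd (lead_toric_nonstandard mo gG lg).
  have [z sz zw] := standard_exists mo apos w.
  have gwz : good (w, z) by [].
  apply/initial_idealP => //; exists (diff_binomial K w z), w; split=> //.
    by apply/GP; exists w, z.
  by case: (leadG _ _ gwz).
- move=> g /GP[w [z [gwz ->]]].
  by exists w; case: (leadG _ _ gwz).
move=> g g' x y /GP[w [z [gwz ->]]] /GP[w' [z' [gwz' ->]]] ne_g.
move=> /(msupp_diff K _ (neq _ _ gwz)) xwz /(lead_unique mo (proj1 (leadG _ _ gwz'))) <-.
have [[nsw minw] sz eq_wz] := gwz; have [[nsw' minw'] sz' eq_wz'] := gwz'.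
apply/negP => le_w'; case: xwz => xE; rewrite xE in le_w'; last first.
  exact/nsw'/(standard_dvd mo sz).
have ww' : w' = w by apply: NNPP => ne; apply: nsw'; apply: minw.
move/eqP: ne_g; apply; rewrite ww'; congr (diff_binomial K _ _).
by apply: (standard_unique mo sz' sz); rewrite -eq_wz' -eq_wz ww'.
Qed.

End Groebner.

(** * Lexicographic orders, circuits and freeness *)

Lemma lcmn_gcdr : right_distributive lcmn gcdn.
Proof. exact: (@Order.DistrLatticeTheory.joinIr _ natdvd). Qed.

Section Lex.
Variable n : nat.
Implicit Types (u v w z m : 'X_{1..n}) (s : seq 'I_n).

(** The lexicographic order in which the variables of s are listed from the
    largest to the smallest one. *)
Fixpoint lexle s u v :=
  if s is i :: s' then (u i < v i) || ((u i == v i) && lexle s' u v) else true.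

Lemma lexle_monomial_order s : (forall i, i \in s) -> monomial_order (lexle s).
Proof.
move=> s_all; split.
- by move=> u v; elim: s {s_all} => //= i s IH; case: ltngtP => //= _; exact: IH.
- move=> u v uv; apply/mnmP => i; move: (s_all i) uv => {s_all}.
  elim: s => // j s IH; rewrite inE /=; case: ltngtP => //= eq_uv.
  by case/orP => [/eqP->//|]; exact: IH.
- move=> v u w; elim: s {s_all} => //= i s IH.
  case: (ltngtP (u i)) => //= [lt_uv _|-> uv].
    case: (ltngtP (v i)) => //= [lt_vw _|<- _]; last by rewrite lt_uv.
    by rewrite (ltn_trans lt_uv lt_vw).
  by case: ltngtP => //= _; apply: IH.
- by move=> m; elim: s {s_all} => //= i s IH; rewrite mnm0E; case: ltngtP.
by move=> m u v; elim: s {s_all} => //= i s IH; rewrite !mnmDE ltn_add2r eqn_add2r;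
  case: ltngtP => //=.
Qed.

(** The elimination property: below a monomial without the first variables
    there are only such monomials. *)
Lemma lexle_zero_prefix pre s u v : (forall i, i \in pre -> v i = 0) ->
  lexle (pre ++ s) u v -> (forall i, i \in pre -> u i = 0) /\ lexle s u v.
Proof.
elim: pre => [|j pre IH] //= v0.
rewrite v0 ?mem_head //= => /andP[/eqP uj /IH[|u0 luv]].
  by move=> i ip; apply: v0; rewrite inE ip orbT.
by split=> // i; rewrite inE => /orP[/eqP->//|]; apply: u0.
Qed.

End Lex.

Section GroebnerCircuits.
Variables (K : fieldType) (n : nat) (a : n.-tuple nat).
Hypothesis apos : forall i, 0 < tnth a i.
Implicit Types (u v w z m : 'X_{1..n}) (i j : 'I_n).

(** Take a lexicographic order in which x_i and x_j are the two smallest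
    variables, in this order. Below a power of x_i or x_j there are only
    monomials in x_i and x_j, and a relation between these is a multiple of
    the circuit. Hence x_i^p is a minimal nonstandard monomial, and x_j^q is
    standard. *)
Lemma circuits_sub_groebner (f : {mpoly K[n]}) :
  circuits a f -> universal_groebner_basis a f.
Proof.
case=> _ [_ [/(circuitP K apos)[i [j [ne_ij -> ->]]] ->]].
pose pre := [seq k <- enum 'I_n | (k != i) && (k != j)].
have preP k : k \in pre = (k != i) && (k != j) by rewrite mem_filter mem_enum andbT.
pose le := lexle (pre ++ [:: i; j]).
have mo : monomial_order le.
  apply: lexle_monomial_order => k; rewrite mem_cat preP !inE.
  by case: (k == i); case: (k == j).
have ne_ji : (j == i) = false by rewrite eq_sym (negPf ne_ij).
have le_pow l x m : l = i \/ l = j -> le m (U_(l) *+ x)%MM ->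
    [/\ m = (U_(i) *+ m i + U_(j) *+ m j)%MM & m i <= if l == i then x else 0].
  move=> lij /lexle_zero_prefix[k|m0].
    rewrite preP powE; case: (l =P k) => // <- /andP[/eqP ni /eqP nj].
    by case: lij.
  rewrite /= powE => lemx; split; last by move: lemx; case: ltngtP.
  apply/mnmP => k; rewrite mnmDE !powE.
  have [<-|ik] := eqVneq i k; first by rewrite ne_ji addn0.
  have [<-|jk] := eqVneq j k; first by [].
  by apply: m0; rewrite preP ![k == _]eq_sym ik.
have AE m : m = (U_(i) *+ m i + U_(j) *+ m j)%MM ->
    Adeg a m = m i * tnth a i + m j * tnth a j.
  by move=> mE; rewrite {1}mE AdegD !Adeg_pow.
apply: (min_nonstandard_groebner _ apos mo).
- split.
    move=> /(_ (U_(j) *+ cexp a j i)%MM); rewrite !Adeg_pow (cexp_swap a j i).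
    move=> /(_ erefl)/(le_pow _ _ _ (or_intror erefl))[_].
    by rewrite powE eqxx ne_ji leqn0 => /eqP c0; have := cexp_gt0 apos i j; rewrite c0.
  move=> m' le_m' ne_m'.
  have m'E : m' = (U_(i) *+ m' i)%MM.
    apply/mnmP => k; rewrite powE; case: eqP => [->//|/eqP/negPf ik].
    by move/mnm_lepP: le_m' => /(_ k); rewrite powE ik leqn0 => /eqP.
  have lt_t : m' i < cexp a i j.
    move: le_m'; rewrite {1}m'E pow_le powE eqxx leq_eqVlt => /orP[/eqP e|//].
    by case: ne_m'; rewrite m'E e.
  rewrite m'E => x; rewrite Adeg_pow => eq_x.
  have [//|lex] := mo_total mo (U_(i) *+ m' i)%MM x.
  have [xE] := le_pow _ _ _ (or_introl erefl) lex; rewrite eqxx => le_x.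
  have : (m' i - x i) * tnth a i = x j * tnth a j.
    by rewrite mulnBl -eq_x (AE _ xE) addKn.
  move=> /(cexp_dvd apos)[k [k1 k2]].
  have k0 : k = 0.
    by apply/eqP; rewrite -leqn0; move: k1 lt_t (cexp_gt0 apos i j); nia.
  rewrite xE k2 k0 mul0n mulm0n addm0.
  suff -> : x i = m' i. by apply: (mo_refl mo).
  by move: k1; rewrite k0 mul0n => /eqP; rewrite subn_eq0 => ?; apply/eqP; rewrite eqn_leq le_x.
- move=> x; rewrite Adeg_pow => eq_x.
  have [//|lex] := mo_total mo (U_(j) *+ cexp a j i)%MM x.
  have [xE] := le_pow _ _ _ (or_intror erefl) lex; rewrite ne_ji leqn0 => /eqP xi.
  have := AE _ xE; rewrite eq_x xi mul0n add0n => /eqP.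
  rewrite eqn_pmul2r // => /eqP xj.
  by rewrite xE xi -xj mulm0n add0m; apply: (mo_refl mo).
- exact: Adeg_cexp.
Qed.

Lemma groebner_sub_circuits :
    (forall u v, primitive_pair a u v -> pure_or_split a u) ->
  forall f : {mpoly K[n]}, universal_groebner_basis a f -> circuits a f.
Proof.
move=> key f /(universal_groebner_form apos)[le [m [s [mo minm ss eq_ms ->]]]].
have mp := min_nonstandard_pair mo apos minm ss eq_ms.
have nz (y w : 'X_{1..n}) : y <> w -> Adeg a y = Adeg a w -> w <> 0%MM.
  by move=> ne_yw eq_yw w0; apply: ne_yw; rewrite w0 in eq_yw *;
    apply: (Adeg_eq0 apos); rewrite eq_yw Adeg0.
have [i mE] : exists i, m = (U_(i) *+ m i)%MM.
  case: (key _ _ mp) => // -[y [w [ne_yw eq_yw le_m]]]; exfalso.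
  have neq t r : (t + r <= m)%MM -> r <> 0%MM -> t <> m.
    move=> /mnm_le_subK[x xE] r0 tm; apply: r0; move: xE; rewrite tm => /mnmP xE.
    by apply/mnmP => k; have := xE k; rewrite !mnmDE mnm0E; lia.
  have le_m' : (w + y <= m)%MM by rewrite addmC.
  case: minm => _ minm; apply: (ne_yw); apply: (standard_unique mo _ _ eq_yw).
    apply: minm; first by apply: lepm_trans le_m; apply: lem_addr.
    exact: neq le_m (nz _ _ ne_yw eq_yw).
  apply: minm; first by apply: lepm_trans le_m'; apply: lem_addr.
  exact: neq le_m' (nz _ _ (nesym ne_yw) (esym eq_yw)).
have [j sE] : exists i, s = (U_(i) *+ s i)%MM.
  case: (key _ _ (primitive_pair_sym mp)) => // -[y [w [ne_yw eq_yw le_s]]]; exfalso.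
  apply: ne_yw; apply: (standard_unique mo) eq_yw; apply: (standard_dvd mo ss).
    by apply: lepm_trans le_s; apply: lem_addr.
  by apply: lepm_trans le_s; apply: lem_addl.
exists m, s; split=> //; apply/(circuitP K apos); exists i, j.
have [_ ne_ms minms] := mp.
have ne_ij : i != j.
  apply/eqP => ij; subst j; apply: ne_ms; rewrite mE sE.
  by move: eq_ms; rewrite mE sE !Adeg_pow => /eqP; rewrite eqn_pmul2r // => /eqP->.
have [k [mi sj]] : exists k, m i = k * cexp a i j /\ s j = k * cexp a j i.
  by apply: (cexp_dvd apos); rewrite -!Adeg_pow -mE -sE.
have k0 : 0 < k.
  rewrite lt0n; apply/eqP => k0; apply: ne_ms.
  by rewrite mE sE mi sj k0 !mul0n !mulm0n.
have [||||] := minms (U_(i) *+ cexp a i j)%MM (U_(j) *+ cexp a j i)%MM.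
- exact: Adeg_cexp.
- move=> /mnmP/(_ i); rewrite !powE eqxx eq_sym (negPf ne_ij) => c0.
  by have := cexp_gt0 apos i j; rewrite c0.
- by rewrite pow_le mi leq_pmull.
- by rewrite pow_le sj leq_pmull.
by move=> <- <-.
Qed.

End GroebnerCircuits.

Section Free.
Variables (n : nat) (a : n.-tuple nat).
Implicit Types (u v w z m : 'X_{1..n}) (i j : 'I_n) (B : {set 'I_n}).

Definition gcd_in B := \big[gcdn/0]_(k in B) tnth a k.

Definition supported B u := forall k, k \notin B -> u k = 0.

(** Freeness for an arrangement concerns an index and the set of the later
    ones; any index i and nonempty set B not containing i occur in this way,
    hence this form of universal freeness ([universally_free_setP]). *)
Definition set_free := forall i B, i \notin B -> B != set0 ->
  exists2 u, supported B u & Adeg a u = lcmn (tnth a i) (gcd_in B).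

Lemma supportedD B u v : supported B u -> supported B v -> supported B (u + v)%MM.
Proof. by move=> su sv k kB; rewrite mnmDE su ?sv. Qed.

Lemma supportedMn B u k : supported B u -> supported B (u *+ k)%MM.
Proof. by move=> su l lB; rewrite mulmnE su. Qed.

Lemma dvdn_gcd_in B k : k \in B -> gcd_in B %| tnth a k.
Proof. by move=> kB; apply: (biggcdn_inf k). Qed.

Lemma gcd_in_dvd_Adeg B u : supported B u -> gcd_in B %| Adeg a u.
Proof.
move=> su; apply: dvdn_sum => k _; have [kB|/su->//] := boolP (k \in B).
by rewrite dvdn_mull ?dvdn_gcd_in.
Qed.

(** Bezout, with the negative coefficients moved to the left-hand side. *)
Lemma bezout_in B x : gcd_in B %| x ->
  exists p q, [/\ supported B p, supported B q & x + Adeg a p = Adeg a q].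
Proof.
pose P x := exists p q, [/\ supported B p, supported B q & x + Adeg a p = Adeg a q].
have PM k y : P y -> P (k * y).
  move=> [p [q [sp sq eq_y]]]; exists (p *+ k)%MM, (q *+ k)%MM.
  by split; rewrite ?AdegMn -?mulnDr ?eq_y //; apply: supportedMn.
suff Pg : P (gcd_in B) by move=> /dvdnP[k ->]; apply: PM.
apply: (big_ind P).
- by exists 0%MM, 0%MM; rewrite Adeg0; split=> // k _; rewrite mnm0E.
- move=> y z Py Pz; have [->|y0] := posnP y; first by rewrite gcd0n.
  case: (egcdnP z y0) => k l kl _.
  have [p [q [sp sq eq_k]]] := PM k _ Py.
  have [p' [q' [sp' sq' eq_l]]] := PM l _ Pz.
  exists (p + q')%MM, (q + p')%MM; split; try exact: supportedD.
  by rewrite !AdegD; move: kl eq_k eq_l; lia.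
move=> k kB; exists 0%MM, U_(k)%MM; rewrite Adeg0 Adeg1 addn0; split=> // l.
  by rewrite mnm0E.
by rewrite mnm1E; case: eqP => // <-; rewrite kB.
Qed.

Lemma gcd_seq_map (t : seq 'I_n) : uniq t ->
  gcd_seq [seq tnth a k | k <- t] = gcd_in [set k in t].
Proof.
move=> ut; rewrite /gcd_seq /gcd_in big_map big_uniq //=.
by apply: eq_bigl => k; rewrite inE.
Qed.

Lemma semigroup_span_map (t : seq 'I_n) (d : nat) : uniq t ->
  semigroup_span [seq tnth a k | k <- t] d <->
  exists2 u, supported [set k in t] u & Adeg a u = d.
Proof.
move=> ut; have AE u : supported [set k in t] u ->
    Adeg a u = \sum_(k <- t) u k * tnth a k.
  move=> su; rewrite big_uniq //= /Adeg [RHS]big_mkcond /=; apply: eq_bigr => k _.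
  by case: ifP => // kt; rewrite su ?inE ?kt.
have [t0|[k0 _]] : t = [::] \/ exists k0, k0 \in t.
- by case: (t) => [|k0 t']; [left|right; exists k0; rewrite mem_head].
- split=> [[x ->]|[u su <-]].
    exists 0%MM => [k _|]; first by rewrite mnm0E.
    by rewrite Adeg0 t0 big_ord0.
  by exists (fun _ => 0); rewrite AE // t0 big_nil big_ord0.
split=> [[x ->]|[u su <-]].
  exists [multinom if k \in t then x (index k t) else 0 | k < n].
    by move=> k; rewrite inE mnmE => /negPf->.
  rewrite AE; last by move=> k; rewrite inE mnmE => /negPf->.
  rewrite size_map (big_nth k0) big_mkord; apply: eq_bigr => l _.
  by rewrite mnmE mem_nth // index_uniq // (nth_map k0).
exists (fun l => u (nth k0 t l)).
rewrite AE // size_map (big_nth k0) big_mkord; apply: eq_bigr => l _.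
by rewrite (nth_map k0).
Qed.

Lemma universally_free_setP : universally_free a <-> set_free.
Proof.
split=> [uf i B iB B0|sf s].
  (* An arrangement in which i is followed exactly by the elements of B. *)
  pose t0 := enum (~: (i |: B)); pose t := t0 ++ i :: enum B.
  have ut : uniq t.
    rewrite cat_uniq cons_uniq !enum_uniq (mem_enum B i) iB !andbT; apply/hasPn => k.
    by rewrite inE /= !mem_enum !inE => ->.
  have pt : perm_eq [seq tnth a k | k <- t] a.
    rewrite -[X in perm_eq _ X](map_tnth_enum a) perm_map // uniq_perm ?enum_uniq // => k.
    rewrite mem_enum mem_cat inE !mem_enum !inE.
    by case: (k == i); case: (k \in B).
  have szB : 0 < size (enum B) by rewrite -cardE card_gt0.
  have lt_t : (size t0).+1 < size [seq tnth a k | k <- t].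
    by rewrite size_map size_cat /= addnS ltnS -{1}[size t0]addn0 ltn_add2l.
  have := uf _ pt _ lt_t.
  have -> : drop (size t0).+1 [seq tnth a k | k <- t] = [seq tnth a k | k <- enum B].
    by rewrite -map_drop drop_cat ltnNge leqnSn subSnn /= drop0.
  rewrite (nth_map i) ?size_cat /= ?addnS ?ltnS ?leq_addr // nth_cat ltnn subnn /=.
  rewrite gcd_seq_map ?enum_uniq // => /semigroup_span_map[|u su uE].
    exact: enum_uniq.
  have EB : [set k in enum B] = B by apply/setP => k; rewrite inE mem_enum.
  by rewrite EB in su uE; exists u.
case/tuple_permP => p sE i lt_i.
(* The arrangement s lists the generators in the order t of their indices. *)
pose t := [seq p k | k <- enum 'I_n].
have {}sE : s = [seq tnth a k | k <- t] by rewrite sE /t -map_comp /= ; apply: eq_map.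
have ut : uniq t by rewrite map_inj_uniq ?enum_uniq //; apply: perm_inj.
rewrite sE size_map in lt_i *.
have k0 : 'I_n by case: (t) lt_i.
have lt_i' : i < size t := ltnW lt_i.
rewrite -map_drop (nth_map k0) // gcd_seq_map ?drop_uniq //.
have [||u su uE] := sf (nth k0 t i) [set k in drop i.+1 t].
- rewrite inE; move: ut; rewrite -{1}(cat_take_drop i t) (drop_nth k0) //.
  by rewrite cat_uniq /= => /and4P[].
- apply/set0Pn; exists (nth k0 t i.+1); rewrite inE (drop_nth k0) //.
  exact: mem_head.
by apply/semigroup_span_map; rewrite ?drop_uniq //; exists u.
Qed.

Hypothesis apos : forall i, 0 < tnth a i.

(** With a lexicographic order in which the variables outside i, B come first,
    then x_i, then those of B, let x = x_i^r x^p' where p' is standard with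
    support in B and x has the degree of some x^q with q supported in B. Then
    x is nonstandard, because x^q is smaller; a minimal nonstandard monomial
    dividing x is a pure power by hypothesis, and does not divide p', hence it
    is x_i^c with c <= r. Its standard form s is supported in B, so that c a_i
    is divisible by lcm(a_i, gcd B) = r a_i. *)
Lemma circuit_groebner_free (K : fieldType) :
  sub_pm (@universal_groebner_basis K n a) (circuits a) -> set_free.
Proof.
move=> UC i B iB B0.
pose pre := [seq k <- enum 'I_n | (k != i) && (k \notin B)].
have preP k : k \in pre = (k != i) && (k \notin B) by rewrite mem_filter mem_enum andbT.
pose le := lexle (pre ++ i :: enum B).
have mo : monomial_order le.
  apply: lexle_monomial_order => k; rewrite mem_cat preP !inE mem_enum.
  by case: (k == i); case: (k \in B).
have le_supp (x y : 'X_{1..n}) : (forall k, k != i -> k \notin B -> y k = 0) -> le x y ->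
    (forall k, k != i -> k \notin B -> x k = 0) /\ x i <= y i.
  move=> y0 /lexle_zero_prefix[k|x0]; first by rewrite preP => /andP[]; apply: y0.
  rewrite /= => lexy; split; last by move: lexy; case: ltngtP.
  by move=> k ki kB; apply: x0; rewrite preP ki.
pose L := lcmn (tnth a i) (gcd_in B).
have g_gt0 : 0 < gcd_in B.
  case/set0Pn: B0 => k kB; rewrite lt0n; apply/eqP => g0.
  by have := dvdn_gcd_in kB; rewrite g0 dvd0n (gtn_eqF (apos k)).
have L_gt0 : 0 < L by rewrite lcmn_gt0 apos.
have /dvdnP[r rE] : tnth a i %| L by apply: dvdn_lcml.
have r_gt0 : 0 < r by move: L_gt0; rewrite rE muln_gt0 => /andP[].
have [p [q [sp sq eq_pq]]] := bezout_in (dvdn_lcmr (tnth a i) (gcd_in B)).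
have [p' sp' eq_p'] := standard_exists mo apos p.
have [p'0 p'i] := le_supp _ _ (fun k _ => sp k) (sp' _ (esym eq_p')).
rewrite sp // leqn0 in p'i; move/eqP: p'i => p'i.
pose x := (U_(i) *+ r + p')%MM.
have eq_x : Adeg a q = Adeg a x by rewrite AdegD Adeg_pow eq_p' -rE.
have nsx : ~ standard a le x.
  move=> /(_ q eq_x)/(le_supp _ _ (fun k _ => sq k))[_].
  by rewrite sq // mnmDE powE eqxx p'i addn0 leqNgt r_gt0.
have [m le_mx minm] := nonstandard_dvd nsx.
have [s ss eq_s] := standard_exists mo apos m.
have mp := min_nonstandard_pair mo apos minm ss (esym eq_s).
have ne_ms : m != s by apply/eqP; case: mp.
have [k [c mE]] : exists k c, m = (U_(k) *+ c)%MM.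
  have Uf := min_nonstandard_groebner K apos mo minm ss (esym eq_s).
  have ne_sm : s != m by rewrite eq_sym.
  case: (UC _ Uf); rewrite ?diff_binomialN => -[u [v [/(circuitP K apos)[k [l [_ -> ->]]] e]]].
    by case: (diff_binomial_inj ne_ms e) => -[-> _]; do 2 eexists; reflexivity.
  by case: (diff_binomial_inj ne_sm e) => -[_ ->]; do 2 eexists; reflexivity.
have m_gt0 : 0 < c.
  rewrite lt0n; apply: contraNneq ne_ms => c0.
  by rewrite mE c0 mulm0n eq_sym (Adeg_eq0 apos (etrans eq_s _)) // mE c0 mulm0n Adeg0.
have le_cx : c <= x k by rewrite -pow_le -mE.
have ki : k = i.
  apply: NNPP => ki; apply: (proj1 minm); apply: (standard_dvd mo sp').
  rewrite mE pow_le; move: le_cx; rewrite mnmDE powE.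
  by case: eqP => // /esym.
subst k; have [s0 s_i] : (forall k, k != i -> k \notin B -> s k = 0) /\ s i <= m i.
  apply: le_supp (ss _ (esym eq_s)) => k ki _.
  by rewrite mE powE eq_sym (negPf ki).
have {}s_i : s i = 0.
  case: (primitive_pair_disjoint apos i mp) => //.
  by rewrite mE powE eqxx => c0; rewrite c0 in m_gt0.
have ss_B : supported B s.
  by move=> k kB; have [->//|ki] := eqVneq k i; apply: s0.
exists s => //; rewrite eq_s -/L; apply/eqP.
rewrite eqn_dvd; apply/andP; split; last first.
  rewrite /L dvdn_lcm -{2}eq_s gcd_in_dvd_Adeg // andbT.
  by rewrite mE Adeg_pow dvdn_mull.
rewrite mE Adeg_pow rE; have le_cr : c <= r.
  by move: le_cx; rewrite mnmDE powE eqxx p'i addn0.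
suff -> : c = r by [].
apply/eqP; rewrite eqn_leq le_cr /= -(leq_pmul2r (apos i)) -rE -Adeg_pow -mE -eq_s.
apply: dvdn_leq.
  by rewrite eq_s mE Adeg_pow muln_gt0 m_gt0 apos.
by rewrite dvdn_lcm gcd_in_dvd_Adeg // eq_s mE Adeg_pow dvdn_mull.
Qed.

End Free.

(** * Universally free semigroups *)

Section FreeGeneration.
Variables (n : nat) (a : n.-tuple nat).
Implicit Types (u v w z m : 'X_{1..n}) (i j p q : 'I_n) (A B : {set 'I_n}).
Hypothesis apos : forall i, 0 < tnth a i.
Hypothesis free : set_free a.

Definition lcm_rest A p := lcmn (tnth a p) (gcd_in a (A :\ p)).

Lemma coord_split u q : exists2 t, u = (t + U_(q) *+ u q)%MM & t q = 0.
Proof.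
have [|t tE] := @mnm_le_subK _ u (U_(q) *+ u q)%MM; first by rewrite pow_le.
exists t => //; apply/eqP; move/mnmP: tE => /(_ q); rewrite mnmDE powE eqxx.
by rewrite -{1}[u q]add0n => /eqP; rewrite eqn_add2r eq_sym.
Qed.

(** Let p minimize lcm_rest A p and write it as a combination of the other
    generators. If a_q occurs in it with coefficient u_q, then u_q a_q is a
    multiple of gcd(A - q), since all the other terms are; so it is a multiple
    of lcm_rest A q, and lcm_rest A q <= u_q a_q <= lcm_rest A p. *)
Lemma free_least_lcm A : 1 < #|A| -> exists p q,
  [/\ p \in A, q \in A, p != q & lcm_rest A p = lcm_rest A q].
Proof.
move=> A1; have [p0 p0A] : exists p0, p0 \in A by apply/card_gt0P; apply: ltnW.
case: (arg_minnP (lcm_rest A) p0A) => p pA' pmin; have {pA'} pA : p \in A := pA'.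
have [||u su eq_u] := free (i := p) (B := A :\ p).
- by rewrite !inE eqxx.
- by rewrite -card_gt0; move: A1; rewrite (cardsD1 p) pA.
have L0 : 0 < lcm_rest A p.
  have [q qA] : exists q, q \in A :\ p.
    by apply/card_gt0P; move: A1; rewrite (cardsD1 p) pA.
  rewrite lcmn_gt0 apos lt0n; apply/eqP => g0.
  by have := dvdn_gcd_in a qA; rewrite g0 dvd0n (gtn_eqF (apos q)).
have [q uq] : exists q, u q != 0.
  by apply: (@Adeg_neq0_coord _ a); rewrite eq_u; apply/eqP; rewrite -lt0n.
have qAp : q \in A :\ p by apply: contraNT uq => /su->.
have /andP[qp qA] : (q != p) && (q \in A) by rewrite -in_setD1.
exists p, q; split=> //; first by rewrite eq_sym.
apply/eqP; rewrite eqn_leq pmin //=.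
apply: leq_trans (_ : u q * tnth a q <= _); last first.
  by rewrite [leqRHS](esym eq_u) leq_term_Adeg.
apply: dvdn_leq; first by rewrite muln_gt0 lt0n uq apos.
rewrite dvdn_lcm dvdn_mull //=.
have [t uE tq] := coord_split u q.
have st : supported (A :\ q) t.
  move=> k; rewrite in_setD1 negb_and negbK => /orP[/eqP->//|kA].
  have := su k; rewrite in_setD1 (negPf kA) andbF => /(_ isT)/eqP.
  by rewrite uE mnmDE addn_eq0 => /andP[/eqP].
have := gcd_in_dvd_Adeg a st => /dvdn_addr <-.
rewrite -(Adeg_pow a q) -AdegD -uE eq_u.
by apply: dvdn_trans (dvdn_lcml _ _); apply: dvdn_gcd_in; rewrite in_setD1 eq_sym qp.
Qed.

(** Induction on B. Apply [free_least_lcm] to i and B: it gives p, q such that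
    a_q divides lcm_rest p and a_p divides lcm_rest q. If i is p or q, the
    other index is the wanted one. Otherwise p can be removed from B without
    changing lcm(a_i, gcd B): as lcm distributes over gcd, it suffices that
    gcd(B - p) divides lcm(a_i, a_p), and indeed it divides a_q, which divides
    lcm_rest p, hence lcm(a_p, a_i). *)
Lemma free_circuit i B : i \notin B -> B != set0 ->
  exists2 j, j \in B & tnth a j %| lcmn (tnth a i) (gcd_in a B).
Proof.
elim: {B}#|B|.+1 {-2}B (ltnSn #|B|) => // k IH B ltB iB B0.
have cA : 1 < #|i |: B| by rewrite cardsU1 iB ltnS card_gt0.
have [p [q [pA qA ne_pq eqL]]] := free_least_lcm cA.
have qL : tnth a q %| lcm_rest (i |: B) p by rewrite eqL dvdn_lcml.
have pL : tnth a p %| lcm_rest (i |: B) q by rewrite -eqL dvdn_lcml.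
have [ip|ne_pi] := eqVneq p i.
  subst p; exists q; last by move: qL; rewrite /lcm_rest setU1K.
  by move: qA; rewrite !inE eq_sym (negPf ne_pq).
have [iq|ne_qi] := eqVneq q i.
  subst q; exists p; last by move: pL; rewrite /lcm_rest setU1K.
  by move: pA; rewrite !inE (negPf ne_pq).
have pB : p \in B by move: pA; rewrite !inE (negPf ne_pi).
have qB : q \in B by move: qA; rewrite !inE (negPf ne_qi).
have qBp : q \in B :\ p by rewrite in_setD1 eq_sym ne_pq.
have [|||j jB ja] := IH (B :\ p).
- by move: ltB; rewrite (cardsD1 p) pB.
- by rewrite in_setD1 (negPf iB) andbF.
- by apply/set0Pn; exists q.
exists j; first by move: jB; rewrite in_setD1 => /andP[].
apply: dvdn_trans ja _.
have -> : gcd_in a B = gcdn (tnth a p) (gcd_in a (B :\ p)).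
  by rewrite /gcd_in (big_setD1 p).
rewrite lcmn_gcdr dvdn_gcd dvdnn andbT dvdn_lcm dvdn_lcml /=.
apply: dvdn_trans (dvdn_gcd_in a qBp) _; apply: dvdn_trans qL _.
rewrite dvdn_lcm dvdn_lcmr /=; apply: dvdn_trans (dvdn_lcml _ _).
by apply: dvdn_gcd_in; rewrite !inE eqxx eq_sym ne_pi.
Qed.

Definition circuit_pair i j u v :=
  u = (U_(i) *+ cexp a i j)%MM /\ v = (U_(j) *+ cexp a j i)%MM.

Lemma cong_two i j u v : i != j -> supported [set i; j] u ->
    supported [set i; j] v -> Adeg a u = Adeg a v -> u i <= v i ->
  cong (circuit_pair i j) u v.
Proof.
move=> ne_ij; have ne_ji : (j == i) = false by rewrite eq_sym (negPf ne_ij).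
have E x : supported [set i; j] x -> x = (U_(i) *+ x i + U_(j) *+ x j)%MM.
  move=> sx; apply/mnmP => k; rewrite mnmDE !powE.
  have [<-|ik] := eqVneq i k; first by rewrite ne_ji addn0.
  have [<-|jk] := eqVneq j k; first by [].
  by apply: sx; rewrite !inE ![k == _]eq_sym negb_or ik.
move=> /E uE /E vE eq_uv le_uv.
have eqd : (v i - u i) * tnth a i = (u j - v j) * tnth a j /\ v j <= u j.
  have eq_t : u i * tnth a i + u j * tnth a j = v i * tnth a i + v j * tnth a j.
    by rewrite -!Adeg_pow -!AdegD -uE -vE.
  have le1 : u i * tnth a i <= v i * tnth a i by rewrite leq_mul2r le_uv orbT.
  rewrite !mulnBl; split; first by lia.
  by rewrite -(leq_pmul2r (apos j)); lia.
have [k [k1 k2]] := cexp_dvd apos (proj1 eqd).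
have vi : v i = u i + cexp a i j * k by rewrite mulnC -k1 subnKC.
have uj : u j = v j + cexp a j i * k by rewrite mulnC -k2 subnKC // (proj2 eqd).
rewrite uE vE vi uj !mulmDn !mulmMn -addmA; apply: cong_addl.
rewrite addmC; apply: cong_add; last exact: cong_refl.
apply: cong_muln; apply: cong_sym; exact: cong_base.
Qed.

Definition weight (c : 'I_n -> rat) u : rat := (\sum_(k < n) c k *+ u k)%R.

Lemma weightD c u v : weight c (u + v)%MM = (weight c u + weight c v)%R.
Proof.
by rewrite /weight -big_split /=; apply: eq_bigr => k _; rewrite mnmDE mulrnDr.
Qed.

Lemma weight_pow c i k : weight c (U_(i) *+ k)%MM = (c i *+ k)%R.
Proof.
rewrite /weight (bigD1 i) //= powE eqxx big1 ?addr0 // => j ne_ji.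
by rewrite powE eq_sym (negPf ne_ji).
Qed.

(** Induction on B from the set {i, j}. A new index k brings, by
    [free_circuit], the circuit with leading term x_k^r where r a_k = lcm(a_k,
    gcd B): it reduces the exponent of x_k below r, and then two monomials of
    the same degree have the same exponent of x_k. The value of the weight c
    at k is chosen so that c takes the same value on the two sides of this
    circuit; in this way c tells the circuit of i and j from all the others. *)
Lemma free_generation i j B : i \in B -> j \in B ->
  exists (R : 'X_{1..n} -> 'X_{1..n} -> Prop) (c : 'I_n -> rat),
  [/\ forall u v, R u v -> (exists k l, k != l /\ circuit_pair k l u v) /\
        [/\ supported B u, supported B v & weight c u = weight c v],
      c i = (i != j)%:R%R, c j = 0%R &
      forall u v, supported B u -> supported B v -> Adeg a u = Adeg a v ->
        cong (fun u v => R u v \/ circuit_pair i j u v) u v].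
Proof.
elim: {B}#|B|.+1 {-2}B (ltnSn #|B|) => // d IH B ltB iB jB.
case: (classic (exists k, [/\ k \in B, k != i & k != j])) => [[k [kB ki kj]]|nex]; last first.
  have Bij k : k \notin [set i; j] -> k \notin B.
    rewrite !inE negb_or => /andP[ki kj]; apply/negP => kB.
    by apply: nex; exists k.
  have sB x : supported B x -> supported [set i; j] x.
    by move=> sx k /Bij/sx.
  exists (fun _ _ => False), (fun k => ((i != j) && (k == i))%:R%R); split=> //.
  - by rewrite eqxx andbT.
  - by case: (eqVneq i j).
  move=> u v /sB su /sB sv eq_uv; have [ij|ne_ij] := eqVneq i j.
    subst j; suff -> : u = v by apply: cong_refl.
    have E x : supported [set i; i] x -> x = (U_(i) *+ x i)%MM.
      move=> sx; apply/mnmP => k; rewrite powE; case: eqP => [->//|/nesym/eqP ki].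
      by apply: sx; rewrite !inE orbb.
    move: eq_uv; rewrite (E u su) (E v sv) !Adeg_pow => /eqP.
    by rewrite eqn_pmul2r // => /eqP->.
  apply: (@cong_generated _ (circuit_pair i j)) => [x y h|]; first by apply/cong_base; right.
  have /orP[le|le] := leq_total (u i) (v i); first exact: cong_two.
  by apply: cong_sym; apply: cong_two.
pose B' := B :\ k.
have iB' : i \in B' by rewrite in_setD1 eq_sym ki.
have jB' : j \in B' by rewrite in_setD1 eq_sym kj.
have kB' : k \notin B' by rewrite in_setD1 eqxx.
have [|R' [c' [R'P c'i c'j genR']]] := IH B' _ iB' jB'.
  by move: ltB; rewrite (cardsD1 k) kB.
have [|l lB' la] := free_circuit kB'; first by apply/set0Pn; exists i.
have ne_kl : k != l by apply: contraNneq kB' => ->.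
have cE : cexp a k l * tnth a k = lcmn (tnth a k) (gcd_in a B').
  apply/eqP; rewrite cexpE eqn_dvd !dvdn_lcm !dvdn_lcml la /=.
  by apply: dvdn_trans (dvdn_lcmr _ _); apply: dvdn_gcd_in.
pose R u v := R' u v \/ circuit_pair k l u v.
pose c x := if x == k then (c' l *+ cexp a l k / (cexp a k l)%:R)%R else c' x.
have lk : l == k = false by rewrite eq_sym (negPf ne_kl).
have sB' x : supported B' x -> supported B x.
  by move=> sx t tB; apply: sx; rewrite in_setD1 (negPf tB) andbF.
have spow (x : 'I_n) t (y : {set 'I_n}) : x \in y -> supported y (U_(x) *+ t)%MM.
  by move=> xy s sy; rewrite powE; case: eqP => // e; rewrite -e xy in sy.
have wc (x : 'X_{1..n}) : supported B' x -> weight c x = weight c' x.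
  move=> sx; apply: eq_bigr => t _; rewrite /c; case: eqP => // ->.
  by rewrite sx // !mulr0n.
have lB : l \in B by move: lB'; rewrite in_setD1 => /andP[].
exists R, c; split.
- move=> u v [/R'P[cp [su sv eq_w]]|[uE vE]].
    by split=> //; split; [exact: sB'|exact: sB'|rewrite !wc].
  split; first by exists k, l.
  rewrite uE vE; split; [exact: spow|exact: spow|].
  rewrite !weight_pow /c eqxx lk -[LHS]mulr_natr divfK //.
  by rewrite Num.Theory.pnatr_eq0 -lt0n cexp_gt0.
- by rewrite /c eq_sym (negPf ki).
- by rewrite /c eq_sym (negPf kj).
pose RR u v := R u v \/ circuit_pair i j u v.
have reduce u : supported B u -> exists r t,
    [/\ r < cexp a k l, supported B' t & cong RR u (U_(k) *+ r + t)%MM].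
  move=> su; have [t tE tk] := coord_split u k.
  have st : supported B' t.
    move=> x; rewrite in_setD1 negb_and negbK => /orP[/eqP->//|xB].
    by have := su x xB; rewrite tE mnmDE => /eqP; rewrite addn_eq0 => /andP[/eqP].
  exists (u k %% cexp a k l), (U_(l) *+ cexp a l k *+ (u k %/ cexp a k l) + t)%MM.
  split; first by rewrite ltn_mod cexp_gt0.
    by apply: supportedD => //; apply: supportedMn; apply: spow.
  rewrite {1}tE {1}(divn_eq (u k) (cexp a k l)) addnC mulnC mulmDn mulmMn.
  rewrite addmC -addmA; apply: cong_addl; apply: cong_add; last exact: cong_refl.
  by apply: cong_muln; apply: cong_base; left; right.
suff ord u v r t r' t' : r <= r' -> r' < cexp a k l -> supported B' t -> supported B' t' ->
    Adeg a (U_(k) *+ r + t)%MM = Adeg a (U_(k) *+ r' + t')%MM ->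
    cong RR (U_(k) *+ r + t)%MM (U_(k) *+ r' + t')%MM.
  move=> u v su sv eq_uv.
  have [r [t [ltr st Cu]]] := reduce u su; have [r' [t' [ltr' st' Cv]]] := reduce v sv.
  apply: (cong_trans Cu); apply: cong_trans (cong_sym Cv).
  have CA x y : cong RR x y -> Adeg a x = Adeg a y.
    apply: (cong_weight (V := nat)) => [x' y'|x' y'].
      by rewrite AdegD.
    case=> [[/R'P[[? [? [_ [-> ->]]]] _]|[-> ->]]|[-> ->]]; exact: Adeg_cexp.
  have eq_rt : Adeg a (U_(k) *+ r + t)%MM = Adeg a (U_(k) *+ r' + t')%MM.
    by rewrite -(CA _ _ Cu) -(CA _ _ Cv).
  have /orP[le|le] := leq_total r r'; first exact: ord.
  by apply: cong_sym; apply: ord.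
move=> le_rr' ltr' st st' eq_rt.
have rr' : r = r'.
  have eqd : (r' - r) * tnth a k + Adeg a t' = Adeg a t.
    move: eq_rt; rewrite !AdegD !Adeg_pow mulnBl.
    have : r * tnth a k <= r' * tnth a k by rewrite leq_mul2r le_rr' orbT.
    move: (r * _) (r' * _) (Adeg a t) (Adeg a t'); clear; lia.
  have : lcmn (tnth a k) (gcd_in a B') %| (r' - r) * tnth a k.
    rewrite dvdn_lcm dvdn_mull //= -(dvdn_addl _ (gcd_in_dvd_Adeg a st')) eqd.
    exact: gcd_in_dvd_Adeg.
  rewrite -cE dvdn_pmul2r // => /dvdnP[x xE]; apply/eqP; rewrite eqn_leq le_rr' /=.
  rewrite -subn_eq0; case: x xE => [->//|x xE].
  have : cexp a k l <= r' by rewrite (leq_trans _ (leq_subr r r')) // xE leq_pmull.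
  by rewrite leqNgt ltr'.
rewrite -rr' in eq_rt *; apply: cong_addl.
apply: (@cong_generated _ (fun u v => R' u v \/ circuit_pair i j u v)).
  by move=> x y [h|h]; apply: cong_base; [left; left|right].
by apply: genR' => //; apply/eqP; move/eqP: eq_rt; rewrite !AdegD eqn_add2l.
Qed.

Lemma free_cong_circuits (K : fieldType) u v :
  Adeg a u = Adeg a v -> cong (circuit K a) u v.
Proof.
move=> eq_uv; have [->|ne_uv] := eqVneq u v; first exact: cong_refl.
have [i _] : exists i, u i != v i.
  apply: NNPP => nex; move/eqP: ne_uv; apply; apply/mnmP => i.
  by apply/eqP/negPn/negP => ne_i; apply: nex; exists i.
have [R [c [RP _ _ gen]]] := free_generation (in_setT i) (in_setT i).
have sT x : supported [set: 'I_n] x by move=> k; rewrite inE.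
apply: cong_generated (gen u v (sT u) (sT v) eq_uv) => x y.
case=> [/RP[[k [l [ne_kl [-> ->]]]] _]|[-> ->]].
  by apply/cong_base/(circuitP K apos); exists k, l.
exact: cong_refl.
Qed.

(** In the generating set of [free_generation], the circuit of i and j cannot
    take part in relations of lower degree, and all the other ones preserve a
    weight that is not the same on its two monomials. *)
Lemma free_circuit_not_lower i j u v : i != j -> circuit_pair i j u v ->
  ~ cong (lower a (Adeg a u)) u v.
Proof.
move=> ne_ij [uE vE].
have [R [c [RP ci cj gen]]] := free_generation (in_setT i) (in_setT j).
have sT x : supported [set: 'I_n] x by move=> k; rewrite inE.
move=> Cuv; have : cong R u v.
  apply: cong_generated Cuv => x y [eq_xy lt_x].
  have homR w z : R w z \/ circuit_pair i j w z -> Adeg a w = Adeg a z.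
    by case=> [/RP[[k [l [_ [-> ->]]]] _]|[-> ->]]; apply: Adeg_cexp.
  apply: cong_generated (cong_homogeneous homR (gen x y (sT x) (sT y) eq_xy)).
  move=> w z [[Rwz|[wE _]] le_w]; first exact: cong_base.
  by move: (leq_ltn_trans le_w lt_x); rewrite wE uE ltnn.
have Rc w z : R w z -> weight c w = weight c z by case/RP => _ [].
move/(cong_weight (weightD c) Rc).
rewrite uE vE !weight_pow ci cj ne_ij mul0rn => /eqP.
rewrite Num.Theory.pnatr_eq0 => /eqP c0.
by have := cexp_gt0 apos i j; rewrite c0.
Qed.

End FreeGeneration.

(** * Betti divisible semigroups *)

Section PurePowers.
Variables (n : nat) (a : n.-tuple nat).
Implicit Types (u v w z m : 'X_{1..n}) (i j : 'I_n).
Hypothesis apos : forall i, 0 < tnth a i.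

(** The least exponent for which x_i^c shares its degree with a monomial free
    of x_i; c a_i is then a Betti degree, see [least_power_betti]. *)
Definition least_power i c :=
  [/\ 0 < c, exists2 u : 'X_{1..n}, u i = 0 & Adeg a u = c * tnth a i &
      forall c' (u : 'X_{1..n}), 0 < c' -> u i = 0 -> Adeg a u = c' * tnth a i -> c <= c'].

Lemma least_power_exists i j : i != j -> exists c, least_power i c.
Proof.
move=> ne_ij; pose P c := asbool
  (0 < c /\ exists2 u : 'X_{1..n}, u i = 0 & Adeg a u = c * tnth a i).
have exP : exists c, P c.
  exists (tnth a j); apply/asboolP; split=> //.
  exists (U_(j) *+ tnth a i)%MM; first by rewrite powE eq_sym (negPf ne_ij).
  by rewrite Adeg_pow mulnC.
case: (ex_minnP exP) => c /asboolP[c0 exu] minc; exists c; split=> // c' u c'0 ui uE.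
by apply/minc/asboolP; split=> //; exists u.
Qed.

(** A step of lower degree starting at x_i^c replaces some x_i^t, t < c, by
    another monomial of the same degree; cancelling x_i in it would contradict
    the minimality of c. *)
Lemma least_power_isolated i c v : least_power i c ->
  cong (lower a (c * tnth a i)) (U_(i) *+ c)%MM v -> v = (U_(i) *+ c)%MM.
Proof.
move=> [c0 _ minc] Cv.
suff step m w z : lower a (c * tnth a i) w z ->
    (m + w = U_(i) *+ c)%MM -> (m + z = U_(i) *+ c)%MM.
  have := cong_invariant (P := fun x => x = (U_(i) *+ c)%MM) _ Cv.
  case=> [m w z [eq_wz lt_w]|h _]; last exact: h.
  by split; apply: step; split=> //; rewrite -eq_wz.
move=> [eq_wz lt_w] mwE; suff -> : z = w by [].
have wE : w = (U_(i) *+ w i)%MM.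
  apply/mnmP => k; rewrite powE; case: eqP => [->//|/eqP/negPf ik].
  by move/mnmP: mwE => /(_ k); rewrite mnmDE powE ik => /eqP; rewrite addn_eq0 => /andP[_ /eqP].
have eq_z : Adeg a z = w i * tnth a i by rewrite -eq_wz {1}wE Adeg_pow.
have lt_wi : w i < c by move: lt_w; rewrite eq_wz eq_z ltn_pmul2r.
have [t zE ti] := coord_split z i.
have le_zw : z i <= w i by rewrite -(leq_pmul2r (apos i)) -eq_z leq_term_Adeg.
have eq_t : Adeg a t = (w i - z i) * tnth a i.
  by rewrite mulnBl -eq_z {1}zE AdegD Adeg_pow addnK.
have wz : w i - z i = 0.
  apply/eqP; rewrite -leqn0 leqNgt; apply/negP => d0.
  by have := minc _ _ d0 ti eq_t; lia.
rewrite zE (Adeg_eq0 apos (_ : Adeg a t = 0)) ?eq_t ?wz // add0m.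
by rewrite [in RHS]wE; congr (U_(i) *+ _)%MM; lia.
Qed.

Lemma least_power_betti (K : fieldType) i c : least_power i c ->
  betti_degree K a (c * tnth a i).
Proof.
move=> lp; have [c0 [u ui uE] _] := lp; rewrite -(Adeg_pow a).
apply: (lower_pair_betti K apos (v := u)); rewrite Adeg_pow ?uE //.
move=> /(least_power_isolated lp) e; move: ui; rewrite e powE eqxx => e0.
by rewrite e0 in c0.
Qed.

Variable c : 'I_n -> nat.
Hypothesis cP : forall i, least_power i (c i).
Let L i := c i * tnth a i.
Hypothesis chain : forall i j, L i %| L j \/ L j %| L i.

Lemma c_gt0 i : 0 < c i. Proof. by case: (cP i). Qed.
Lemma L_gt0 i : 0 < L i. Proof. by rewrite muln_gt0 c_gt0 apos. Qed.

(** The lcm is a multiple of a_j in the semigroup generated by a_i, so it is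
    at least L_j. *)
Lemma chain_lcm i j : i != j -> L i %| L j -> L j %| lcmn (tnth a j) (tnth a i).
Proof.
move=> ne_ij Lij; set l := lcmn _ _.
have l0 : 0 < l by rewrite lcmn_gt0 !apos.
have lL : l %| L j.
  by rewrite dvdn_lcm dvdn_mull //=; apply: dvdn_trans Lij; rewrite dvdn_mull.
have [/dvdnP[t tE] /dvdnP[t' t'E]] : tnth a j %| l /\ tnth a i %| l.
  by rewrite dvdn_lcml dvdn_lcmr.
have t0 : 0 < t by move: l0; rewrite tE muln_gt0 => /andP[].
have le_t : c j <= t.
  have [_ _ minc] := cP j; apply: (minc _ (U_(i) *+ t')%MM) => //.
    by rewrite powE (negPf ne_ij).
  by rewrite Adeg_pow -t'E tE.
suff -> : L j = l by [].
by apply/eqP; rewrite eqn_leq (dvdn_leq (L_gt0 j) lL) andbT tE leq_mul2r le_t orbT.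
Qed.

Lemma chain_le i j : L i <= L j -> L i %| L j.
Proof.
by case: (chain i j) => // /(dvdn_leq (L_gt0 i)) h h'; rewrite (_ : L i = L j) //; lia.
Qed.

(** Take t with L_t maximal among the indices that violate the claim. For any
    other x, L_t divides lcm(a_t, u_x a_x): either L_x divides L_t and
    [chain_lcm] applies, or c_x divides u_x and then L_t divides L_x, which
    divides u_x a_x. The same holds for v. As lcm distributes over gcd, L_t
    divides lcm(a_t, g) for the gcd g of all these terms, and u_t a_t or v_t
    a_t is a combination of them. *)
Lemma chain_blocks u v : (forall i, u i = 0 \/ v i = 0) -> Adeg a u = Adeg a v ->
  forall i, c i %| u i /\ c i %| v i.
Proof.
move=> dis eq_uv i.
pose bad i := ~~ ((c i %| u i) && (c i %| v i)).
suff nbad : forall i, ~~ bad i by apply/andP; move: (nbad i); rewrite negbK.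
move=> {}i; apply/negP => bad_i.
case: (arg_maxnP L bad_i) => t bad_t maxt.
have good x : x != t -> L t %| lcmn (tnth a t) (gcdn (u x * tnth a x) (v x * tnth a x)).
  move=> ne_xt; case: (leqP (L x) (L t)) => [/chain_le Lxt|ltL].
    apply: dvdn_trans (chain_lcm ne_xt Lxt) _.
    by rewrite dvdn_lcm dvdn_lcml; apply: dvdn_trans (dvdn_lcmr _ _); rewrite dvdn_gcd !dvdn_mull.
  have /negPn/andP[cu cv] : ~~ bad x.
    apply/negP => bad_x; have le_x : L x <= L t := maxt x bad_x.
    by rewrite leqNgt ltL in le_x.
  apply: dvdn_trans (chain_le (ltnW ltL)) _; apply: dvdn_trans (dvdn_lcmr _ _).
  by rewrite dvdn_gcd !dvdn_mul.
pose g := \big[gcdn/0]_(x | x != t) gcdn (u x * tnth a x) (v x * tnth a x).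
have Lg : L t %| lcmn (tnth a t) g.
  apply: (big_ind (fun y => L t %| lcmn (tnth a t) y)); first by rewrite lcmn0.
    by move=> y z hy hz; rewrite lcmn_gcdr dvdn_gcd hy.
  exact: good.
have [U [gU UE]] : exists U, g %| U /\ Adeg a u = u t * tnth a t + U.
  exists (\sum_(x | x != t) u x * tnth a x); split; last by rewrite /Adeg (bigD1 t).
  apply: dvdn_sum => x xt; apply: dvdn_trans (dvdn_gcdl _ (v x * tnth a x)).
  exact: (biggcdn_inf x).
have [V [gV VE]] : exists V, g %| V /\ Adeg a v = v t * tnth a t + V.
  exists (\sum_(x | x != t) v x * tnth a x); split; last by rewrite /Adeg (bigD1 t).
  apply: dvdn_sum => x xt; apply: dvdn_trans (dvdn_gcdr (u x * tnth a x) _).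
  exact: (biggcdn_inf x).
have fin x : g %| x * tnth a t -> c t %| x.
  move=> gx; rewrite -(dvdn_pmul2r (apos t)); apply: dvdn_trans Lg _.
  by rewrite dvdn_lcm dvdn_mull.
have eqUV : u t * tnth a t + U = v t * tnth a t + V by rewrite -UE -VE.
move/negP: bad_t; apply; case: (dis t) => e0.
  rewrite e0 dvdn0 /=; apply: fin; rewrite -(dvdn_addl _ gV) -eqUV e0.
  by rewrite mul0n.
rewrite e0 dvdn0 andbT; apply: fin; rewrite -(dvdn_addl _ gU) eqUV e0.
by rewrite mul0n.
Qed.

(** As long as the degree exceeds N, remove a block x_i^{c_i} with the
    smallest L_i: it divides both N and the degree, so that the degree remains
    at least N. *)
Lemma knapsack N u : (forall i, c i %| u i) -> (forall i, u i != 0 -> L i %| N) ->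
    N <= Adeg a u ->
  exists w, [/\ (w <= u)%MM, forall i, c i %| w i & Adeg a w = N].
Proof.
elim: {u}(Adeg a u).+1 {-2}u (ltnSn (Adeg a u)) => // k IH u ltu cu Lu leN.
have [NE|neN] := eqVneq N (Adeg a u); first by exists u; rewrite lepm_refl.
have ltN : N < Adeg a u by rewrite ltn_neqAle neN.
have [i0 ui0] : exists i, u i != 0.
  by apply: (@Adeg_neq0_coord _ a) => u0; rewrite u0 in ltN.
case: (arg_minnP L (P := fun i => u i != 0) ui0) => i ui mini.
have [t tE] : exists t, u = (t + U_(i) *+ c i)%MM.
  by apply: mnm_le_subK; rewrite pow_le dvdn_leq // lt0n.
have LiU : L i %| Adeg a u.
  apply: dvdn_sum => x _; have [->|ux] := eqVneq (u x) 0; first by rewrite dvdn0.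
  by apply: dvdn_trans (chain_le (mini x ux)) _; apply: dvdn_mul.
have AtE : Adeg a u = Adeg a t + L i by rewrite {1}tE AdegD Adeg_pow.
have [||x tx||w [le_w cw wE]] := IH t.
- by have := L_gt0 i; lia.
- move=> x; move: (cu x); rewrite tE mnmDE powE; case: eqP => [<-|_]; last by rewrite addn0.
  by rewrite dvdn_addl.
- by apply: Lu; rewrite tE mnmDE addn_eq0 (negPf tx).
- have /dvdnP[x xE] := LiU; have /dvdnP[y yE] := Lu i ui.
  have lt_yx : y < x by move: ltN; rewrite xE yE ltn_pmul2r ?L_gt0.
  by rewrite -(leq_add2r (L i)) -AtE xE yE -mulSnr leq_mul2r lt_yx orbT.
by exists w; split=> //; apply: lepm_trans le_w _; rewrite tE lem_addr.
Qed.

(** Since L_j is at most the degree of u, [knapsack] finds in u a factor of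
    degree L_j, to be compared with the factor x_j^{c_j} of v. *)
Lemma chain_primitive_pair u v j : primitive_pair a u v -> v j != 0 ->
    (forall x, (u x != 0) || (v x != 0) -> L x %| L j) ->
  v = (U_(j) *+ c j)%MM /\ forall i, c i %| u i.
Proof.
move=> mp vj top; have dis x := primitive_pair_disjoint apos x mp.
have [eq_uv _ minuv] := mp.
have cuv := chain_blocks dis eq_uv.
have le_v : (U_(j) *+ c j <= v)%MM.
  by rewrite pow_le dvdn_leq ?lt0n //; case: (cuv j).
have [|x ux||w [le_w cw wE]] := @knapsack (L j) u.
- by move=> x; case: (cuv x).
- by apply: top; rewrite ux.
- by rewrite eq_uv; move: (leq_Adeg a le_v); rewrite Adeg_pow.
have [||_ <-] := minuv w _ _ _ le_w le_v; [by rewrite wE Adeg_pow| |].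
  move=> we; have := pow_le j (c j) u; rewrite -we le_w => /esym.
  case: (dis j) => e; last by rewrite e in vj.
  by rewrite e leqn0 => /eqP e0; have := c_gt0 j; rewrite e0.
by split=> // x; case: (cuv x).
Qed.

Lemma chain_top u v : primitive_pair a u v ->
  exists j, ((u j != 0) || (v j != 0)) /\
    forall x, (u x != 0) || (v x != 0) -> L x %| L j.
Proof.
move=> mp; have [_ ne_uv _] := mp.
have [i0 ui0] : exists i, (u i != 0) || (v i != 0).
  apply: NNPP => nex; apply: ne_uv; apply/mnmP => i.
  case: (boolP ((u i != 0) || (v i != 0))) => [h|]; first by case: nex; exists i.
  by rewrite negb_or !negbK => /andP[/eqP-> /eqP->].
case: (arg_maxnP L (P := fun i => (u i != 0) || (v i != 0)) ui0) => j uj maxj.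
by exists j; split=> // x ux; apply/chain_le/maxj.
Qed.

(** One of the two monomials is a power x_j^{c_j}, which is alone in its
    class. *)
Lemma chain_primitive_not_lower u v :
  primitive_pair a u v -> ~ cong (lower a (Adeg a u)) u v.
Proof.
suff half u' v' j : primitive_pair a u' v' -> v' j != 0 ->
    (forall x, (u' x != 0) || (v' x != 0) -> L x %| L j) ->
    ~ cong (lower a (Adeg a v')) v' u'.
  move=> mp; have [j [uvj top]] := chain_top mp.
  have [eq_uv _ _] := mp; have [vj|vj0] := boolP (v j != 0).
    by rewrite eq_uv => /cong_sym; apply: half top.
  apply: (half _ _ j (primitive_pair_sym mp)); first by rewrite (negPf vj0) orbF in uvj.
  by move=> x; rewrite orbC; apply: top.
move=> mp vj top; have [vE _] := chain_primitive_pair mp vj top.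
rewrite vE Adeg_pow => /(least_power_isolated (cP j)) uE.
by have [_ ne_uv _] := mp; apply: ne_uv; rewrite uE vE.
Qed.

(** The case of interest is v = x_j^{c_j}. Let L_k be the largest among the
    variables of u. What remains of u without x_k has a degree that is a
    multiple of L_k; if it is not 1, [knapsack] finds in it a factor of degree
    L_k, the degree of the factor x_k^{c_k} of u. *)
Lemma chain_pure_or_split u v : primitive_pair a u v ->
  pure_or_split a u.
Proof.
move=> mp; have [j [uvj top]] := chain_top mp; have [eq_uv _ _] := mp.
have [vj|vj0] := boolP (v j != 0); last first.
  rewrite (negPf vj0) orbF in uvj; left; exists j.
  have [|uE _] := chain_primitive_pair (primitive_pair_sym mp) uvj.
    by move=> x; rewrite orbC; apply: top.
  by rewrite {2}uE powE eqxx.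
have [vE cu] := chain_primitive_pair mp vj top.
have uL : Adeg a u = L j by rewrite eq_uv vE Adeg_pow.
have [i0 ui0] : exists i, u i != 0.
  by apply: (@Adeg_neq0_coord _ a); rewrite uL; have := L_gt0 j; case: (L j).
case: (arg_maxnP L (P := fun i => u i != 0) ui0) => k uk maxk.
have [t tE tk] := coord_split u k.
have [t0|t0] := eqVneq t 0%MM.
  by left; exists k; rewrite {1}tE t0 add0m.
right; have tx x : t x != 0 -> u x != 0 /\ x != k.
  move=> tx; split; first by rewrite tE mnmDE addn_eq0 (negPf tx).
  by apply: contraNneq tx => ->; rewrite tk.
have [x|x /tx[ux _]||w [le_w _ wE]] := @knapsack (L k) t.
- have [e|/tx[ux xk]] := eqVneq (t x) 0; first by rewrite e dvdn0.
  by have := cu x; rewrite tE mnmDE powE eq_sym (negPf xk) addn0.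
- exact/chain_le/maxk.
- apply: dvdn_leq.
    by rewrite lt0n; apply: contraNneq t0 => /(Adeg_eq0 apos)->.
  have LuU : L k %| Adeg a u by rewrite uL; apply: top; rewrite uk.
  move: LuU; rewrite {1}tE AdegD Adeg_pow dvdn_addl //.
  by apply: dvdn_mul.
exists w, (U_(k) *+ c k)%MM; split.
- move=> we; have := mnm_lepP le_w k; rewrite we powE eqxx tk leqn0 => /eqP ck.
  by have := c_gt0 k; rewrite ck.
- by rewrite wE Adeg_pow.
rewrite tE; apply/mnm_lepP => x; rewrite !mnmDE leq_add ?(mnm_lepP le_w) // !powE.
by case: eqP => // _; apply: dvdn_leq => //; rewrite lt0n.
Qed.

End PurePowers.

Section BettiDivisible.
Variables (K : fieldType) (n : nat) (a : n.-tuple nat).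
Implicit Types (u v : 'X_{1..n}).
Hypothesis apos : forall i, 0 < tnth a i.
Hypothesis betti : betti_divisible K a.

Lemma betti_chain u v : primitive_pair a u v ->
  exists2 c : 'I_n -> nat, forall i, least_power a i (c i) &
    forall i j, c i * tnth a i %| c j * tnth a j \/ c j * tnth a j %| c i * tnth a i.
Proof.
move=> mp; have [eq_uv ne_uv _] := mp.
have [i ui] := neq_pair_coord apos eq_uv ne_uv.
have [j vj] := neq_pair_coord apos (esym eq_uv) (nesym ne_uv).
have ne_ij : i != j.
  by apply/eqP => ij; subst j; case: (primitive_pair_disjoint apos i mp) => h; rewrite h in ui vj.
have [k|c cP] := @fin_all_exists _ _ (fun k c => least_power a k c).
  have [->|ki] := eqVneq k i; first exact: least_power_exists ne_ij.
  exact: least_power_exists ki.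
exists c => // k l; apply: betti; exact: least_power_betti.
Qed.

Lemma betti_primitive_not_lower u v :
  primitive_pair a u v -> ~ cong (lower a (Adeg a u)) u v.
Proof.
move=> mp; have [c cP chain] := betti_chain mp.
exact: chain_primitive_not_lower chain _ _ mp.
Qed.

Lemma betti_pure_or_split u v : primitive_pair a u v ->
  pure_or_split a u.
Proof.
move=> mp; have [c cP chain] := betti_chain mp.
exact: chain_pure_or_split chain _ _ mp.
Qed.

End BettiDivisible.

(** * Minimal generating sets *)

Section MinimalGenerators.
Variables (n : nat) (a : n.-tuple nat).
Implicit Types (u w : 'X_{1..n}).

Lemma semigroup_span_tuple d : semigroup_span a d <-> exists u, Adeg a u = d.
Proof.
rewrite -{1}(map_tnth_enum a) semigroup_span_map ?enum_uniq //.
split=> [[u _ <-]|[u <-]]; first by exists u.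
by exists u => // k; rewrite inE mem_enum inE.
Qed.

(** d is in the semigroup generated by the a_k with k <> i. *)
Definition avoids i d := exists2 w : 'X_{1..n}, w i = 0 & Adeg a w = d.

Lemma avoids0 i : avoids i 0.
Proof. by exists 0%MM; rewrite ?mnm0E ?Adeg0. Qed.

Lemma avoidsD i d e : avoids i d -> avoids i e -> avoids i (d + e).
Proof.
move=> [u ui <-] [w wi <-]; exists (u + w)%MM; last by rewrite AdegD.
by rewrite mnmDE ui wi.
Qed.

Lemma avoidsM i k d : avoids i d -> avoids i (k * d).
Proof.
by move=> [u ui <-]; exists (u *+ k)%MM; rewrite ?AdegMn // mulmnE ui.
Qed.

Lemma minimal_irredundant S i : minimal_generating_set S a -> ~ avoids i (tnth a i).
Proof.
move=> [srt gen minS] [w wi wE].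
have inj : injective (tnth a).
  by apply/tuple_uniqP; apply: sorted_uniq srt; [exact: ltn_trans|exact: ltnn].
pose t := [seq k <- enum 'I_n | k != i].
have ut : uniq t by rewrite filter_uniq ?enum_uniq.
have : tnth a i \in [seq tnth a k | k <- t].
  apply: minS; last exact: mem_tnth.
    by move=> x /mapP[k _ ->]; apply: mem_tnth.
  move=> d; rewrite gen semigroup_span_tuple semigroup_span_map //.
  split=> [[u <-]|[u _ <-]]; last by exists u.
  have [s sE si] := coord_split u i.
  exists (s + w *+ u i)%MM; last by rewrite [in RHS]sE !AdegD AdegMn Adeg_pow wE.
  move=> k; rewrite inE mem_filter mem_enum andbT negbK => /eqP->.
  by rewrite mnmDE mulmnE si wi.
by case/mapP => k; rewrite mem_filter => /andP[/eqP ki _] /inj/esym.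
Qed.

Lemma minimal_pos S i : minimal_generating_set S a -> 0 < tnth a i.
Proof.
move=> /(minimal_irredundant (i := i)) nav; rewrite lt0n; apply/eqP => a0.
by apply: nav; rewrite a0; apply: avoids0.
Qed.

Lemma irredundant_minimal : sorted ltn a -> (forall i, ~ avoids i (tnth a i)) ->
  minimal_generating_set (semigroup_span a) a.
Proof.
move=> srt irr; split=> // s sa gen x /tnthP[i xE].
apply/negPn/negP => xs; apply: (irr i); rewrite -xE.
have /gen[y ->] : semigroup_span a x.
  by apply/semigroup_span_tuple; exists U_(i)%MM; rewrite Adeg1.
apply: (big_ind (avoids i)); [exact: avoids0|exact: avoidsD|] => l _.
apply: avoidsM; have ls : nth 0 s l \in s by rewrite mem_nth.
have /tnthP[k kE] := sa _ ls; exists U_(k)%MM; last by rewrite Adeg1 kE.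
rewrite mnm1E; case: eqP => // ki; move: xs; rewrite xE -ki -kE ls //.
Qed.

End MinimalGenerators.

(** A generator x of a that is not in b is a combination of elements of b
    smaller than x; expressed through a, these do not use x, so x would be
    redundant. *)
Lemma minimal_generating_sub S n (a : n.-tuple nat) m (b : m.-tuple nat) :
  minimal_generating_set S a -> minimal_generating_set S b -> {subset a <= b}.
Proof.
move=> mA mB x /tnthP[i xE]; apply/negPn/negP => xb.
apply: (minimal_irredundant (i := i) mA); rewrite -xE.
have [_ genA _] := mA; have [_ genB _] := mB.
have /genB/semigroup_span_tuple[u uE] : S x.
  by apply/genA/semigroup_span_tuple; exists U_(i)%MM; rewrite Adeg1.
rewrite -uE; apply: (big_ind (avoids a i)); [exact: avoids0|exact: avoidsD|] => k _.
have [->|uk] := posnP (u k); first exact: avoids0.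
have le_x : u k * tnth b k <= x by rewrite -uE leq_term_Adeg.
have lt_x : tnth b k < x.
  rewrite ltn_neqAle (leq_trans _ le_x) ?leq_pmull // andbT.
  by apply: contraNneq xb => <-; apply: mem_tnth.
apply: avoidsM; have /genA/semigroup_span_tuple[w wE] : S (tnth b k).
  by apply/genB/semigroup_span_tuple; exists U_(k)%MM; rewrite Adeg1.
exists w => //; apply/eqP; rewrite -leqn0 leqNgt; apply/negP => wi.
move: (leq_term_Adeg a w i); rewrite wE -xE leqNgt => /negP; apply.
by apply: leq_trans lt_x _; rewrite leq_pmull.
Qed.

(** The minimal generating set of a semigroup is unique, hence a family can be
    tested on any presentation of it. *)
Lemma semigroups_with_minimal (P : forall n, n.-tuple nat -> Prop) S m (b : m.-tuple nat) :
  minimal_generating_set S b -> semigroups_with P S -> P m b.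
Proof.
move=> mB [_ [n [a [mA PA]]]].
have eq_ab : val a = val b.
  have [srtA _ _] := mA; have [srtB _ _] := mB.
  apply: (irr_sorted_eq ltn_trans ltnn) => // x.
  by apply/idP/idP; [apply: (minimal_generating_sub mA mB)|apply: (minimal_generating_sub mB mA)].
have nm : n = m by rewrite -(size_tuple a) -(size_tuple b) /= eq_ab.
by subst m; rewrite -(val_inj eq_ab).
Qed.

(** * Comparison of the toric bases *)

Section Families.
Variable K : fieldType.

Section OneSemigroup.
Variables (n : nat) (a : n.-tuple nat).
Hypothesis apos : forall i, 0 < tnth a i.

Lemma markov_graver :
    (forall u v, primitive_pair a u v -> ~ cong (lower a (Adeg a u)) u v) ->
  eq_pm (@universal_markov_basis K n a) (@graver_basis K n a).
Proof.
move=> low; split=> f.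
  move=> uf; left; have [B [[binB _] _] Bf] := uf.
  have [_ [u [v fE]]] := binB f Bf; rewrite fE in uf *.
  by exists u, v; split=> //; apply/primitiveP/(markov_primitive apos uf).
case=> u [v [/primitiveP mp ->]]; left.
by apply: not_lower_markov => //; [case: mp|apply: low].
Qed.

Lemma circuits_groebner :
    (forall u v, primitive_pair a u v -> pure_or_split a u) ->
  eq_pm (@circuits K n a) (@universal_groebner_basis K n a).
Proof.
move=> key; split=> f; first by left; apply: circuits_sub_groebner.
by left; apply: groebner_sub_circuits.
Qed.

Lemma circuits_generate :
    (forall u v, Adeg a u = Adeg a v -> cong (circuit K a) u v) ->
  forall f, toric_ideal a f <-> ideal_gen (@circuits K n a) f.
Proof.
move=> gen f; split.
  apply: toric_ideal_gen => u v /gen; apply: cong_ideal_gen => w z cwz.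
  by apply: ideal_gen_mem; exists w, z.
by apply: ideal_gen_trans => g [u [v [[[? _ _] _ _] ->]]].
Qed.

Lemma free_circuits_markov : set_free a ->
  sub_pm (@circuits K n a) (@universal_markov_basis K n a).
Proof.
move=> sf _ [u [v [/(circuitP K apos)[i [j [ne_ij uE vE]]] ->]]]; left.
apply: not_lower_markov => //; first by rewrite uE vE Adeg_cexp.
by apply: (free_circuit_not_lower apos sf ne_ij).
Qed.

End OneSemigroup.

(** * The semigroup generated by 60, 84, 350 and 525 *)

(** A gluing: (60, 84) = 12 (5, 7) and (350, 525) = 175 (2, 3), where 12 and 175
    are coprime, 12 is in the semigroup of 2 and 3, and 175 in that of 5 and 7.
    The relations inside the two pairs have degrees 420 and 1050, and the one
    between the pairs has degree 2100 = 12 * 175. *)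
Definition gens4 : 4.-tuple nat := [tuple 60; 84; 350; 525].

Lemma numerical_span (s : seq nat) : all (leq 1) s -> gcd_seq s = 1 ->
  numerical_semigroup (semigroup_span s).
Proof. by exists s. Qed.

Section Example0.
Local Notation a := gens4.
Local Notation o0 := (@Ordinal 4 0 isT).
Local Notation o1 := (@Ordinal 4 1 isT).
Local Notation o2 := (@Ordinal 4 2 isT).
Local Notation o3 := (@Ordinal 4 3 isT).
Implicit Types (u v w z : 'X_{1..4}).

Lemma ord4 (P : 'I_4 -> Prop) : P o0 -> P o1 -> P o2 -> P o3 -> forall i, P i.
Proof.
move=> P0 P1 P2 P3 [[|[|[|[|//]]]] lt_i].
- by rewrite (_ : Ordinal lt_i = o0) //; apply: val_inj.
- by rewrite (_ : Ordinal lt_i = o1) //; apply: val_inj.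
- by rewrite (_ : Ordinal lt_i = o2) //; apply: val_inj.
- by rewrite (_ : Ordinal lt_i = o3) //; apply: val_inj.
Qed.

(** Stated with variables so that no conversion ever unfolds large numerals. *)
Lemma Adeg_tuple4 x0 x1 x2 x3 u : Adeg [tuple x0; x1; x2; x3] u =
  x0 * u o0 + x1 * u o1 + x2 * u o2 + x3 * u o3.
Proof.
have E0 : ord0 = o0 by apply: val_inj.
have E1 : lift ord0 ord0 = o1 by apply: val_inj.
have E2 : lift ord0 (lift ord0 ord0) = o2 by apply: val_inj.
have E3 : lift ord0 (lift ord0 (lift ord0 ord0)) = o3 by apply: val_inj.
rewrite /Adeg; under eq_bigr do rewrite (tnth_nth 0) mulnC.
by rewrite !big_ord_recl big_ord0 E3 E2 E1 E0 addn0 !addnA.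
Qed.

Lemma Adeg_gens4 u :
  Adeg a u = 60 * u o0 + 84 * u o1 + 350 * u o2 + 525 * u o3.
Proof. exact: Adeg_tuple4. Qed.

Lemma minimal_gens4 : minimal_generating_set (semigroup_span a) a.
Proof.
apply: irredundant_minimal => //; apply: ord4 => -[w];
  rewrite Adeg_gens4 => w0; rewrite w0 /tnth /=; lia.
Qed.

Lemma pos_gens4 i : 0 < tnth a i.
Proof. exact: minimal_pos minimal_gens4. Qed.

(** Each of the primes 7, 5, 3, 2 divides all the generators but one, whose
    exponents on the two sides are therefore congruent; one of them is 0. *)
Lemma dvd_gens4 u v : Adeg a u = Adeg a v -> (forall i, u i = 0 \/ v i = 0) ->
  exists p q r s, [/\ u o0 = 7 * p, u o1 = 5 * q, u o2 = 3 * r & u o3 = 2 * s].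
Proof.
rewrite !Adeg_gens4 => e dis.
have [p pE] : exists p, u o0 = 7 * p.
  exists (u o0 %/ 7); case: (dis o0); move: e; lia.
have [q qE] : exists q, u o1 = 5 * q.
  exists (u o1 %/ 5); case: (dis o1); move: e; lia.
have [r rE] : exists r, u o2 = 3 * r.
  exists (u o2 %/ 3); case: (dis o2); move: e; lia.
have [s sE] : exists s, u o3 = 2 * s.
  exists (u o3 %/ 2); case: (dis o3); move: e; lia.
by exists p, q, r, s.
Qed.

Definition mon4 x0 x1 x2 x3 : 'X_{1..4} :=
  [multinom nth 0 [:: x0; x1; x2; x3] i | i < 4].

Lemma mon4E x0 x1 x2 x3 (m := mon4 x0 x1 x2 x3) :
  [/\ m o0 = x0, m o1 = x1, m o2 = x2 & m o3 = x3].
Proof. by rewrite /m !mnmE. Qed.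

Lemma eta_mon4 u : u = mon4 (u o0) (u o1) (u o2) (u o3).
Proof. by apply/mnmP; apply: ord4; rewrite mnmE. Qed.

Lemma mon4_le x0 x1 x2 x3 u : x0 <= u o0 -> x1 <= u o1 -> x2 <= u o2 -> x3 <= u o3 ->
  (mon4 x0 x1 x2 x3 <= u)%MM.
Proof. by move=> *; apply/mnm_lepP; apply: ord4; rewrite mnmE. Qed.

Lemma Adeg_mon4 x0 x1 x2 x3 :
  Adeg a (mon4 x0 x1 x2 x3) = 60 * x0 + 84 * x1 + 350 * x2 + 525 * x3.
Proof. by rewrite Adeg_gens4; have [-> -> -> ->] := mon4E x0 x1 x2 x3. Qed.

(** The degrees of the three kinds of pairs are 420, 1050 and 2100. *)
Definition special_pair u v :=
  [\/ u = mon4 7 0 0 0 /\ v = mon4 0 5 0 0,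
      u = mon4 0 0 3 0 /\ v = mon4 0 0 0 2 |
      exists b e, [/\ b <= 5, e <= 2, u = mon4 (7 * (5 - b)) (5 * b) 0 0 &
                      v = mon4 0 0 (3 * (2 - e)) (2 * e)]].

Lemma primitive_hit u v x0 x1 x2 x3 y0 y1 y2 y3 :
    primitive_pair a u v -> [|| x0 != y0, x1 != y1, x2 != y2 | x3 != y3] ->
    Adeg a (mon4 x0 x1 x2 x3) = Adeg a (mon4 y0 y1 y2 y3) ->
    [/\ x0 <= u o0, x1 <= u o1, x2 <= u o2 & x3 <= u o3] ->
    [/\ y0 <= v o0, y1 <= v o1, y2 <= v o2 & y3 <= v o3] ->
  u = mon4 x0 x1 x2 x3 /\ v = mon4 y0 y1 y2 y3.
Proof.
move=> [_ _ minuv] ne eq_d [? ? ? ?] [? ? ? ?].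
have [//||||-> ->//] := minuv (mon4 x0 x1 x2 x3) (mon4 y0 y1 y2 y3).
- move/mnmP => e; move: ne (e o0) (e o1) (e o2) (e o3); rewrite !mnmE /=.
  by move=> /[swap]-> /[swap]-> /[swap]-> /[swap]->; rewrite !eqxx.
- exact: mon4_le.
- exact: mon4_le.
Qed.

(** Divide the exponents as in [dvd_gens4]: what remains is the equation 2 (p
    + q) + 5 (r + s) = 2 (p' + q') + 5 (r' + s'). If none of the first two
    kinds of special pairs is below (u, v) or (v, u), then p, q and p', q' are
    not both nonzero, nor are r, s and r', s', and the equation puts a pair of
    the third kind below. *)
Lemma primitive_special u v :
  primitive_pair a u v -> special_pair u v \/ special_pair v u.
Proof.
move=> mp; have mp' := primitive_pair_sym mp.
have dis i := primitive_pair_disjoint pos_gens4 i mp.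
have dis' i := primitive_pair_disjoint pos_gens4 i mp'.
have [eq_uv ne_uv _] := mp.
have [p [q [r [s [u0 u1 u2 u3]]]]] := dvd_gens4 eq_uv dis.
have [p' [q' [r' [s' [v0 v1 v2 v3]]]]] := dvd_gens4 (esym eq_uv) dis'.
case: (boolP ((0 < p) && (0 < q'))) => [h|h1].
  by left; constructor 1; apply: (primitive_hit mp) => //;
    [rewrite !Adeg_mon4|split; lia|split; lia].
case: (boolP ((0 < p') && (0 < q))) => [h|h2].
  by right; constructor 1; apply: (primitive_hit mp') => //;
    [rewrite !Adeg_mon4|split; lia|split; lia].
case: (boolP ((0 < r) && (0 < s'))) => [h|h3].
  by left; constructor 2; apply: (primitive_hit mp) => //;
    [rewrite !Adeg_mon4|split; lia|split; lia].
case: (boolP ((0 < r') && (0 < s))) => [h|h4].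
  by right; constructor 2; apply: (primitive_hit mp') => //;
    [rewrite !Adeg_mon4|split; lia|split; lia].
have eq_pq : 2 * (p + q) + 5 * (r + s) = 2 * (p' + q') + 5 * (r' + s').
  by move: eq_uv; rewrite !Adeg_gens4 u0 u1 u2 u3 v0 v1 v2 v3; clear; lia.
have nz : 0 < p + q + r + s + p' + q' + r' + s'.
  rewrite lt0n; apply/eqP => z0; apply: ne_uv.
  by rewrite (eta_mon4 u) (eta_mon4 v) u0 u1 u2 u3 v0 v1 v2 v3; congr mon4; move: z0; clear; lia.
case: (boolP ((5 <= p + q) && (2 <= r' + s'))) => [h|h5].
  left; constructor 3; exists (minn q 5), (minn s' 2); rewrite !geq_minr.
  suff [-> ->] : u = mon4 (7 * (5 - minn q 5)) (5 * minn q 5) 0 0 /\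
    v = mon4 0 0 (3 * (2 - minn s' 2)) (2 * minn s' 2) by [].
  apply: (primitive_hit mp); [|rewrite !Adeg_mon4|split|split]; lia.
case: (boolP ((5 <= p' + q') && (2 <= r + s))) => [h|h6].
  right; constructor 3; exists (minn q' 5), (minn s 2); rewrite !geq_minr.
  suff [-> ->] : v = mon4 (7 * (5 - minn q' 5)) (5 * minn q' 5) 0 0 /\
    u = mon4 0 0 (3 * (2 - minn s 2)) (2 * minn s 2) by [].
  apply: (primitive_hit mp'); [|rewrite !Adeg_mon4|split|split]; lia.
exfalso; move: (dis o0) (dis o1) (dis o2) (dis o3) h1 h2 h3 h4 h5 h6 eq_pq nz.
rewrite u0 u1 u2 u3 v0 v1 v2 v3; clear; lia.
Qed.

Lemma lower_invariant_gens4 d (f : 'X_{1..4} -> nat) u v :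
    {morph f : u v / (u + v)%MM >-> u + v} ->
    (forall w z, Adeg a w = Adeg a z -> Adeg a w < d -> f w = f z) ->
  f u <> f v -> ~ cong (lower a d) u v.
Proof.
move=> fD inv ne Cuv; apply: ne; apply: (cong_weight (V := nat)) Cuv => //.
by move=> w z [eq_wz lt_w]; apply: inv.
Qed.

(** In each case an additive function is preserved by all the relations of
    lower degree: the exponent of the first or of the third variable, or the
    part of the degree that comes from the first two variables. *)
Lemma special_not_lower u v : special_pair u v -> ~ cong (lower a (Adeg a u)) u v.
Proof.
case=> [[-> ->]|[-> ->]|[b [e [lb le -> ->]]]]; rewrite Adeg_mon4.
- apply: (lower_invariant_gens4 (f := fun u => u o0)) => [x y|w z|]; first by rewrite mnmDE.
    by rewrite !Adeg_gens4; lia.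
  by rewrite /mon4 !mnmE.
- apply: (lower_invariant_gens4 (f := fun u => u o2)) => [x y|w z|]; first by rewrite mnmDE.
    by rewrite !Adeg_gens4; lia.
  by rewrite /mon4 !mnmE.
apply: (lower_invariant_gens4 (f := fun u => 5 * u o0 + 7 * u o1)) => [x y|w z|].
- by rewrite !mnmDE; lia.
- by rewrite !Adeg_gens4; lia.
have [-> -> _ _] := mon4E (7 * (5 - b)) (5 * b) 0 0.
have [-> -> _ _] := mon4E 0 0 (3 * (2 - e)) (2 * e).
by lia.
Qed.

Lemma pure_or_split_block01 x0 x1 :
  (0 < x0 -> 7 <= x0) -> (0 < x1 -> 5 <= x1) -> pure_or_split a (mon4 x0 x1 0 0).
Proof.
move=> h0 h1; have [E0|x0p] := posnP x0.
  by left; exists o1; apply/mnmP; apply: ord4; rewrite powE !mnmE //= E0.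
have [E1|x1p] := posnP x1.
  by left; exists o0; apply/mnmP; apply: ord4; rewrite powE !mnmE //= E1.
right; exists (mon4 7 0 0 0), (mon4 0 5 0 0); split.
- by move/mnmP => /(_ o0); rewrite !mnmE.
- by rewrite !Adeg_mon4.
- by apply/mnm_lepP; apply: ord4; rewrite mnmDE !mnmE //= ?addn0 ?add0n; [apply: h0|apply: h1].
Qed.

Lemma pure_or_split_block23 x2 x3 :
  (0 < x2 -> 3 <= x2) -> (0 < x3 -> 2 <= x3) -> pure_or_split a (mon4 0 0 x2 x3).
Proof.
move=> h2 h3; have [E2|x2p] := posnP x2.
  by left; exists o3; apply/mnmP; apply: ord4; rewrite powE !mnmE //= E2.
have [E3|x3p] := posnP x3.
  by left; exists o2; apply/mnmP; apply: ord4; rewrite powE !mnmE //= E3.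
right; exists (mon4 0 0 3 0), (mon4 0 0 0 2); split.
- by move/mnmP => /(_ o2); rewrite !mnmE.
- by rewrite !Adeg_mon4.
- by apply/mnm_lepP; apply: ord4; rewrite mnmDE !mnmE //= ?addn0 ?add0n; [apply: h2|apply: h3].
Qed.

Lemma special_pure_or_split u v :
  special_pair u v -> pure_or_split a u /\ pure_or_split a v.
Proof.
case=> [[-> ->]|[-> ->]|[b [e [lb le -> ->]]]].
- by split; apply: pure_or_split_block01.
- by split; apply: pure_or_split_block23.
split; [apply: pure_or_split_block01|apply: pure_or_split_block23]; lia.
Qed.

Lemma F1_F2_not_F0 : exists S, family_cap (F1 K) (F2 K) S /\ ~ F0 K S.
Proof.
exists (semigroup_span a); split.
  have num : numerical_semigroup (semigroup_span a).
    apply: numerical_span => //.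
    by rewrite /gcd_seq !big_cons big_nil.
  split; split=> //; exists 4, a; split; try exact: minimal_gens4.
    apply: (markov_graver pos_gens4) => u v mp; have [eq_uv _ _] := mp.
    case: (primitive_special mp) => [|/special_not_lower]; first exact: special_not_lower.
    by rewrite -eq_uv => nC /cong_sym.
  apply: (circuits_groebner pos_gens4) => u v /primitive_special.
  by case=> /special_pure_or_split [].
move=> /(semigroups_with_minimal minimal_gens4) betti.
have betti_special u v : special_pair u v -> Adeg a u = Adeg a v -> betti_degree K a (Adeg a u).
  by move=> sp eq_uv; apply: (lower_pair_betti K pos_gens4 eq_uv); apply: special_not_lower.
have b1 : betti_degree K a (Adeg a (mon4 7 0 0 0)).
  by apply: (betti_special _ (mon4 0 5 0 0)); [constructor 1|rewrite !Adeg_mon4].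
have b2 : betti_degree K a (Adeg a (mon4 0 0 3 0)).
  by apply: (betti_special _ (mon4 0 0 0 2)); [constructor 2|rewrite !Adeg_mon4].
by case: (betti _ _ b1 b2); rewrite !Adeg_mon4; lia.
Qed.

End Example0.

(** * The semigroup generated by 4, 6 and 9 *)

Definition gens3 : 3.-tuple nat := [tuple 4; 6; 9].

Section Example3.
Local Notation a := gens3.
Local Notation o0 := (@Ordinal 3 0 isT).
Local Notation o1 := (@Ordinal 3 1 isT).
Local Notation o2 := (@Ordinal 3 2 isT).
Implicit Types (u v w z : 'X_{1..3}).

Lemma ord3 (P : 'I_3 -> Prop) : P o0 -> P o1 -> P o2 -> forall i, P i.
Proof.
move=> P0 P1 P2 [[|[|[|//]]] lt_i].
- by rewrite (_ : Ordinal lt_i = o0) //; apply: val_inj.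
- by rewrite (_ : Ordinal lt_i = o1) //; apply: val_inj.
- by rewrite (_ : Ordinal lt_i = o2) //; apply: val_inj.
Qed.

Lemma Adeg_gens3 u : Adeg a u = 4 * u o0 + 6 * u o1 + 9 * u o2.
Proof.
have E0 : ord0 = o0 by apply: val_inj.
have E1 : lift ord0 ord0 = o1 by apply: val_inj.
have E2 : lift ord0 (lift ord0 ord0) = o2 by apply: val_inj.
rewrite /Adeg; under eq_bigr do rewrite (tnth_nth 0) mulnC.
by rewrite !big_ord_recl big_ord0 E2 E1 E0 addn0 !addnA.
Qed.

Lemma minimal_gens3 : minimal_generating_set (semigroup_span a) a.
Proof.
apply: irredundant_minimal => //; apply: ord3 => -[w];
  rewrite Adeg_gens3 => w0; rewrite w0 /tnth /=; lia.
Qed.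

Lemma pos_gens3 i : 0 < tnth a i.
Proof. exact: minimal_pos minimal_gens3. Qed.

(** The circuits x^3 - y^2 and z^2 - y^3 reduce the exponents of x and z
    modulo 3 and 2; the degree determines such a normal form. *)
Lemma cong_normal_gens3 u : cong (circuit K a) u
  (U_(o0) *+ (u o0 %% 3) + U_(o1) *+ (u o1 + 2 * (u o0 %/ 3) + 3 * (u o2 %/ 2))
   + U_(o2) *+ (u o2 %% 2))%MM.
Proof.
have C01 : cong (circuit K a) (U_(o0) *+ 3)%MM (U_(o1) *+ 2)%MM.
  by apply/cong_base/(circuitP K pos_gens3); exists o0, o1.
have C21 : cong (circuit K a) (U_(o2) *+ 2)%MM (U_(o1) *+ 3)%MM.
  by apply/cong_base/(circuitP K pos_gens3); exists o2, o1.
have uE : u = ((U_(o0) *+ 3 *+ (u o0 %/ 3) + U_(o2) *+ 2 *+ (u o2 %/ 2))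
    + (U_(o0) *+ (u o0 %% 3) + U_(o1) *+ u o1 + U_(o2) *+ (u o2 %% 2)))%MM.
  by apply/mnmP; apply: ord3; rewrite !mnmDE !mulmnE !mnm1E /=; lia.
rewrite {1}uE; apply: (@cong_trans _ _ _
    ((U_(o1) *+ 2 *+ (u o0 %/ 3) + U_(o1) *+ 3 *+ (u o2 %/ 2))
    + (U_(o0) *+ (u o0 %% 3) + U_(o1) *+ u o1 + U_(o2) *+ (u o2 %% 2)))%MM).
  by apply: cong_add (cong_refl _ _); apply: cong_add; apply: cong_muln.
set x := (X in cong _ X _); set y := (X in cong _ _ X); suff -> : x = y by apply: cong_refl.
by apply/mnmP; apply: ord3; rewrite !mnmDE !mulmnE !mnm1E /=; lia.
Qed.

Lemma F5_not_F3 : exists S, F5 K S /\ ~ F3 S.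
Proof.
exists (semigroup_span a); split.
  split; first by apply: numerical_span => //; rewrite /gcd_seq !big_cons big_nil.
  exists 3, a; split; first exact: minimal_gens3.
  apply: circuits_generate => u v; rewrite !Adeg_gens3 => eq_uv.
  apply: cong_trans (cong_normal_gens3 u) _; apply: cong_sym.
  have [-> [-> ->]] : u o0 %% 3 = v o0 %% 3 /\ (u o2 %% 2 = v o2 %% 2 /\
     u o1 + 2 * (u o0 %/ 3) + 3 * (u o2 %/ 2) = v o1 + 2 * (v o0 %/ 3) + 3 * (v o2 %/ 2)).
    by split; [|split]; lia.
  exact: cong_normal_gens3.
move=> /(semigroups_with_minimal minimal_gens3) /(_ [:: 6; 4; 9] isT 0 isT).
case=> x; rewrite /gcd_seq /= !big_cons big_nil !big_ord_recl big_ord0 /=.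
rewrite (_ : lcmn _ _ = 6) //; lia.
Qed.

End Example3.
End Families.

(** * The inclusions *)

Theorem proposition5p3 (K : fieldType) :
  [/\ family_proper (F0 K) (family_cap (F1 K) (F2 K)),
      family_sub (family_cup (F1 K) F3) (F4 K) &
      family_sub (F2 K) F3 /\ family_proper F3 (F5 K)].
Proof.
split; [split; last exact: F1_F2_not_F0| |split; last (split; last exact: F5_not_F3)].
- move=> S [num [n [a [mA betti]]]]; have apos i : 0 < tnth a i := minimal_pos i mA.
  split; split=> //; exists n, a; split=> //.
    by apply: markov_graver => // u v; apply: (betti_primitive_not_lower apos betti).
  by apply: circuits_groebner => // u v; apply: (betti_pure_or_split apos betti).
- move=> S [] [num [n [a [mA Pa]]]]; have apos i : 0 < tnth a i := minimal_pos i mA;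
    split=> //; exists n, a; split=> // f.
    by move=> /(circuits_sub_graver apos); apply: (proj2 Pa).
  by apply: free_circuits_markov => //; apply/universally_free_setP.
- move=> S [num [n [a [mA [_ UC]]]]]; have apos i : 0 < tnth a i := minimal_pos i mA.
  split=> //; exists n, a; split=> //; apply/universally_free_setP.
  exact: circuit_groebner_free UC.
move=> S [num [n [a [mA uf]]]]; have apos i : 0 < tnth a i := minimal_pos i mA.
split=> //; exists n, a; split=> //; apply: circuits_generate => u v.
by apply: free_cong_circuits => //; apply/universally_free_setP.
Qed.
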